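(* Assume $\diamondsuit$ and Kurepa's Hypothesis. Then there is a compact space $Y$ of cardinality $2^{\mathfrak{c}}$ such that $Y^n$ is hereditarily separable for all $n<\omega$, and such that the space $C_p(Y)$ is countably tight, $(C_p(Y))^n$ is Lindelöf for all $n<\omega$, and $C_p(Y)$ is not a Grothendieck space.
   Context: All spaces are infinite and completely regular (Hausdorff included). $\mathfrak{c}=2^{\aleph_0}$. Kurepa's Hypothesis is the statement that there exists a Kurepa tree (a tree of height $\omega_1$ with countable levels and at least $\omega_2$ cofinal branches). $C_p(X)$ denotes the set of continuous real-valued functions on $X$ with the topology of pointwise convergence, inherited from the product $\mathbb{R}^X$. A space $X$ is countably tight if whenever $A \subseteq X$ and $x \in \overline{A}$, there is a countable $B \subseteq A$ with $x \in \overline{B}$. A subset $A \subseteq X$ is countably compact in $X$ if every infinite subset of $A$ has a limit point in $X$. $X$ is a $g$-space if each $A \subseteq X$ which is countably compact in $X$ has compact closure in $X$. $X$ is a hereditary $g$-space if every subspace of $X$ is a $g$-space. $X$ is a Grothendieck space if $C_p(X)$ is a hereditary $g$-space. *)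

(* Defs.v *)
From HB Require Import structures.
From mathcomp Require Import all_boot all_order all_algebra.
From mathcomp Require Import all_classical all_reals all_analysis.

Set Implicit Arguments.
Unset Strict Implicit.
Unset Printing Implicit Defensive.

Import Order.TTheory GRing.Theory Num.Theory.
Import numFieldNormedType.Exports.

Local Open Scope classical_set_scope.
Local Open Scope card_scope.
Local Open Scope order_scope.

Definition well_ordered_set d (T : porderType d) (A : set T) : Prop :=
  forall B : set T, B `<=` A -> B !=set0 ->
    exists2 m, B m & forall x, B x -> m <= x.

(* [W] has the order type of the successor cardinal of |K|: it is a well-order
   of cardinality greater than |K|, and all its proper initial segments have
   cardinality at most |K|. *)
Definition successor_cardinal (K : Type) d (W : orderType d) : Prop :=
  [/\ well_ordered_set [set: W],
      ~ ([set: W] #<= [set: K]) &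
      forall a : W, [set b | b < a] #<= [set: K]].

(* [W] has order type omega_1; the elements of [W] then stand for the
   countable ordinals. *)
Definition is_omega1 d (W : orderType d) : Prop := successor_cardinal nat W.

Section Diamond.
Context d (W : orderType d).
Implicit Types (C S : set W) (a b c : W).

Definition unbounded C : Prop := forall a, exists2 b, C b & a < b.

(* As the inequalities [b < c < a] are strict, the hypotheses make [a] a
   nonzero limit ordinal and a limit of elements of [C]. *)
Definition closed_in_order C : Prop :=
  forall a, (exists b, b < a) ->
    (forall b, b < a -> exists2 c, C c & b < c < a) -> C a.

Definition club C : Prop := unbounded C /\ closed_in_order C.

Definition stationary S : Prop := forall C, club C -> S `&` C !=set0.

Definition diamond_sequence (D : W -> set W) : Prop :=
  (forall a, D a `<=` [set b | b < a]) /\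
  (forall X : set W, stationary [set a | X `&` [set b | b < a] = D a]).

End Diamond.

Definition diamond : Prop :=
  exists (d : Order.disp_t) (W : orderType d),
    is_omega1 W /\ exists D : W -> set W, diamond_sequence D.

Section Trees.
Context d (T : porderType d) d' (W : orderType d').

Definition tree : Prop := forall t : T, well_ordered_set [set s | s < t].

(* The level of [T] with index the ordinal [a], that is, the order type of
   [set b : W | b < a]. *)
Definition level (a : W) : set T :=
  [set t | exists2 f : T -> W, set_bij [set s | s < t] [set b | b < a] f &
     forall r s, r < t -> s < t -> (f r < f s) = (r < s)].

(* Every ordinal below the order type of [W] indexes a nonempty level, and
   there is no other nonempty level. *)
Definition has_height : Prop :=
  (forall a : W, level a !=set0) /\ (forall t : T, exists a : W, level a t).

Definition branch (B : set T) : Prop :=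
  total_on B (fun s t => s <= t) /\
  forall B' : set T, total_on B' (fun s t => s <= t) -> B `<=` B' -> B' = B.

Definition cofinal_branch (B : set T) : Prop :=
  branch B /\ forall a : W, B `&` level a !=set0.

End Trees.

(* [W] is omega_1 and [V] is omega_2. *)
Definition Kurepa_hypothesis : Prop :=
  exists (d1 : Order.disp_t) (W : orderType d1)
         (d2 : Order.disp_t) (V : orderType d2)
         (d3 : Order.disp_t) (T : porderType d3),
    is_omega1 W /\ successor_cardinal W V /\
    [/\ tree T,
        has_height T W,
        forall a : W, countable (level a : set T) &
        [set: V] #<= [set B : set T | cofinal_branch W B]].

Section Spaces.
Implicit Type X : topologicalType.

Definition separable X : Prop := exists2 D : set X, countable D & dense D.

(* The coercion of [A] to a type carries the subspace topology. *)
Definition hereditarily_separable X : Prop := forall A : set X, separable A.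

Definition lindelof X : Prop :=
  forall U : set (set X), (forall u, U u -> open u) ->
    \bigcup_(u in U) u = [set: X] ->
    exists V : set (set X),
      [/\ V `<=` U, countable V & \bigcup_(u in V) u = [set: X]].

Definition countably_tight X : Prop :=
  forall (A : set X) (x : X), closure A x ->
    exists B : set X, [/\ B `<=` A, countable B & closure B x].

Definition countably_compact_in X (A : set X) : Prop :=
  forall B : set X, B `<=` A -> infinite_set B -> limit_point B !=set0.

Definition g_space X : Prop :=
  forall A : set X, countably_compact_in A -> compact (closure A).

Definition hereditary_g_space X : Prop := forall A : set X, g_space A.

Definition power X (n : nat) : topologicalType := {ptws 'I_n -> X}.

Definition Cp (R : realType) X : topologicalType :=
  [set f : {ptws X -> R} | continuous (f : X -> R)].

Definition Grothendieck_space (R : realType) X : Prop :=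
  hereditary_g_space (Cp R X).

End Spaces.

(* Main.v *)
Require Import Defs.
From mathcomp Require Import all_boot all_order all_algebra.
From mathcomp Require Import all_classical all_reals all_analysis.

Set Implicit Arguments.
Unset Strict Implicit.
Unset Printing Implicit Defensive.

Import Order.TTheory GRing.Theory Num.Theory.
Import numFieldNormedType.Exports.

Local Open Scope classical_set_scope.
Local Open Scope card_scope.
Local Open Scope order_scope.

(* The space is Y = { y in 2^omega_1 : y(b) = f_b(y|b) whenever y|b <> D_b },
   where D is the diamond sequence, so that the point D_b of 2^b, and only it, is
   split at stage b, and where f_b is a continuous function on 2^b \ {D_b}, generic
   enough that the following holds: D_g also codes a guessed sequence of finite
   tuples in 2^g and, if the tuple (x_1, ..., x_n) of points of Y is a limit of the
   guessed tuples at stage g, it remains a limit at all later stages, however the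
   guessed tuples are extended to tuples of points of Y.
   - Every y in Y satisfies y|b = D_b for stationarily many b, so every branch splits
     omega_1 times and Y has 2^omega_1 points; diamond gives omega_1 = c.
   - An uncountable left-separated sequence in Y^n, with n minimal, can be thinned to
     one without repeated coordinates. If D_g guesses it at a sufficiently closed g,
     its term number g is in the closure of the previous ones, a contradiction.
   - If p is a limit of a countable set T and D_g guesses T, every q in Y with
     q|g = p|g is a limit of T. So each complement Y \ {p} is countably compact in
     itself; it is dense, and Y embeds in C_p(C_p(Y)).
   - C_p(Y)^n is covered by boxes given by finitely many points of Y and as many
     rational intervals; for each list of intervals, hereditary separability of Y^m
     reduces the tuples of points to countably many, whence Lindelof. Countable
     tightness is the compactness of the powers of Y. *)

(** * The first uncountable ordinal *)

Lemma countableU (T : Type) (A B : set T) :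
  countable A -> countable B -> countable (A `|` B).
Proof.
move=> cA cB; rewrite -bigcup2E; apply: bigcup_countable => //.
by move=> [|[|n]] _ //=; exact: countable0.
Qed.

Lemma card_le_setT_inj (T U : Type) (B : set U) : [set: T] #<= B ->
  exists2 f : T -> U, injective f & forall x, B (f x).
Proof.
move=> /card_leP[v].
exists (fun x => val (v (SigSub (mem_set (I : [set: T] x))))) => [x y|x].
  by move=> /val_inj/inj; rewrite !inE => /(_ I I)/(congr1 val).
exact/set_mem/valP.
Qed.

Section Omega1.
Context d (W : orderType d) (hW : is_omega1 W).
Implicit Types (a b : W) (A U X : set W).

Lemma omega1_wf : well_founded (fun a b : W => a < b).
Proof.
have [wo _ _] := hW => a; apply: contrapT => na.
have [m nm mmin] := wo [set x | ~ Acc (fun a b : W => a < b) x]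
  (fun _ _ => I) (ex_intro _ a na).
apply: nm; constructor => y ym; apply: contrapT => ny.
by have := mmin y ny; rewrite leNgt ym.
Qed.

Lemma omega1_min A : A !=set0 -> exists2 m, A m & forall x, A x -> m <= x.
Proof. by have [wo _ _] := hW => A0; apply: wo. Qed.

(** Recursion along [W] with a choice at each stage. As [P a f v] reads [f] only below [a], the
    history may be padded with [t0]. *)
Lemma transfinite_choice (T : Type) (t0 : T) (P : W -> (W -> T) -> T -> Prop) :
  (forall a f g v, (forall b, b < a -> f b = g b) -> P a f v -> P a g v) ->
  (forall a f, exists v, P a f v) ->
  exists f, forall a, P a f (f a).
Proof.
move=> loc ex.
pose ext a (rec : forall b, b < a -> T) b : T :=
  if pselect (b < a) is left h then rec b h else t0.
pose F a rec := projT1 (cid (ex a (@ext a rec))).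
pose f := Fix omega1_wf (fun=> T) F.
exists f => a; rewrite /f Fix_eq; last first.
  move=> x g h gh; congr F.
  by apply: functional_extensionality_dep => y;
     apply: functional_extensionality_dep => p.
rewrite /F; case: cid => v /= Pv; apply: loc Pv => b ba.
by rewrite /ext; case: pselect.
Qed.

Lemma uncountable_omega1 : ~ countable [set: W].
Proof. by have [_ + _] := hW. Qed.

Lemma countable_lt a : countable [set b | b < a].
Proof. by have [_ _] := hW; apply. Qed.

Lemma countable_le a : countable [set b | b <= a].
Proof.
have -> : [set b | b <= a] = [set b | b < a] `|` [set a].
  apply/seteqP; split=> b /=; first by rewrite le_eqVlt => /orP[/eqP|]; [right|left].
  by case=> [/ltW|->].
by apply: countableU; [exact: countable_lt|exact: countable1].
Qed.

Lemma omega1_bounded A : countable A -> exists a, forall b, A b -> b < a.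
Proof.
move=> cA; apply: contrapT => nb; apply: uncountable_omega1.
apply: (sub_countable (B := \bigcup_(b in A) [set a | a <= b])).
  apply: subset_card_le => a _; apply: contrapT => na; apply: nb; exists a => b Ab.
  by rewrite ltNge; apply/negP => ab; apply: na; exists b.
by apply: bigcup_countable => // b _; exact: countable_le.
Qed.

Lemma omega1_gt a : exists b, a < b.
Proof. by have [b /(_ a erefl)] := omega1_bounded (countable1 a); exists b. Qed.

Lemma omega1_inhabited : exists a : W, True.
Proof.
apply: contrapT => h; apply: uncountable_omega1.
rewrite (_ : [set: W] = set0) ?countable0//.
by apply/seteqP; split=> // a _; apply: h; exists a.
Qed.

(** At stage [a] only countably many values are excluded, namely those up to an earlier [g b] or in
    [bad (g b)], so an uncountable [U] has one left. *)
Lemma thinning U (bad : W -> set W) : ~ countable U ->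
    (forall a, countable (bad a)) ->
  exists g : W -> W, (forall a, U (g a)) /\
    forall a b, a < b -> g a < g b /\ ~ bad (g a) (g b).
Proof.
move=> ncU cbad; have [a0 _] := omega1_inhabited.
pose P a f v := U v /\ forall b, b < a -> f b < v /\ ~ bad (f b) v.
have [|a f|g gP] := @transfinite_choice W a0 P.
- by move=> a f g v fg [Uv h]; split=> // b ba; rewrite -fg//; exact: h.
- apply: contrapT => nv; apply: ncU.
  apply: (sub_countable
    (B := \bigcup_(b in [set b | b < a]) ([set v | v <= f b] `|` bad (f b)))).
    apply: subset_card_le => v Uv; apply: contrapT => nb; apply: nv; exists v.
    split=> // b ba; split; last by move=> ?; apply: nb; exists b => //; right.
    by rewrite ltNge; apply/negP => ?; apply: nb; exists b => //; left.
  apply: bigcup_countable => [|b _]; first exact: countable_lt.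
  by apply: countableU => //; exact: countable_le.
- by exists g; split=> [a|a b ab]; [have [] := gP a|have [_] := gP b; apply].
Qed.

Lemma countable_seq_sub (T : eqType) (A : set T) : countable A ->
  countable [set s : seq T | {in s, forall x, A x}].
Proof.
move=> /countable_injP[f fi]; apply/countable_injP.
exists (pickle \o map f) => s t; rewrite !inE => sA tA /=.
move=> /(pcan_inj pickleK).
elim: s t sA tA => [|x s ih] [|y t]//= sA tA [] /fi xy st.
rewrite xy ?inE; last 2 first.
- exact: (sA x (mem_head _ _)).
- exact: (tA y (mem_head _ _)).
by congr cons; apply: ih st => z zi; [apply: sA|apply: tA]; rewrite inE zi orbT.
Qed.

Lemma seq_bound (a0 : W) a (E : seq W) : a0 < a -> {in E, forall x, x < a} ->
  exists2 b, b < a & {in E, forall x, x <= b}.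
Proof.
move=> a0a; elim: E => [_|x E ih h]; first by exists a0.
have [|b ba hb] := ih; first by move=> y yE; apply: h; rewrite inE yE orbT.
exists (Order.max x b); first by rewrite gt_max ba h// mem_head.
move=> y; rewrite inE le_max => /orP[/eqP->|/hb ->]; rewrite ?lexx// orbT//.
Qed.

(** The nonzero ordinals closed under [K] form a club, so the diamond sequence guesses [X] at one of
    them. Finite lists as arguments of [K] encode closure under functions of several ordinals. *)
Lemma diamond_reflection (D : W -> set W) (K : seq W -> set W) X :
    diamond_sequence D -> (forall E, countable (K E)) ->
  exists a, X `&` [set b | b < a] = D a /\
    forall E, {in E, forall x, x < a} -> forall b, K E b -> b < a.
Proof.
move=> [_ /(_ X) statX] cK.
pose C := [set a | (exists b, b < a) /\
  forall E, {in E, forall x, x < a} -> forall b, K E b -> b < a].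
suff [a [/= Da [_ Ca]]] : [set a | X `&` [set b | b < a] = D a] `&` C !=set0.
  by exists a.
apply: statX; split.
- move=> a.
  have /choice[next nextP] b : exists c, b < c /\
      forall E, {in E, forall x, x <= b} -> forall e, K E e -> e < c.
    have [|c hc] := @omega1_bounded ([set b] `|`
      \bigcup_(E in [set E : seq W | {in E, forall x, x <= b}]) K E).
      apply: countableU; first exact: countable1.
      by apply: bigcup_countable => //; exact/countable_seq_sub/countable_le.
    exists c; split=> [|E Eb e KE]; first by apply: hc; left.
    by apply: hc; right; exists E.
  (* The limit of these iterates is closed under [K]: a finite list below it already lies below some
     [s n], and [next] bounds what [K] adds. *)
  pose s n := iter n next a.
  have sS n : s n < s n.+1 by have [] := nextP (s n).
  have smono n m : (n <= m)%N -> s n <= s m.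
    elim: m => [|m ih]; first by rewrite leqn0 => /eqP->.
    by rewrite leq_eqVlt => /orP[/eqP->//|/ih h]; exact: le_trans h (ltW (sS m)).
  have [b0 b0P] : exists b, forall n, s n < b.
    have [|b hb] := @omega1_bounded (range s).
      exact: (sub_countable (card_image_le _ _)).
    by exists b => n; apply: hb; exists n.
  have [b bs bmin] := omega1_min (ex_intro _ b0 b0P : [set b | forall n, s n < b] !=set0).
  have below x : x < b -> exists n, x <= s n.
    move=> xb; apply: contrapT => h.
    have /bmin : [set b | forall n, s n < b] x.
      by move=> n /=; rewrite ltNge; apply/negP => xs; apply: h; exists n.
    by rewrite leNgt xb.
  exists b; last exact: (bs 0%N).
  split; first by exists a; exact: (bs 0%N).
  move=> E Eb e KE.
  have [n En] : exists n, {in E, forall x, x <= s n}.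
    elim: E Eb {KE} => [|x E ih] h; first by exists 0%N.
    have [y yE|n En] := ih; first by apply: h; rewrite inE yE orbT.
    have [|m xm] := below x; first by apply: h; rewrite mem_head.
    exists (maxn n m) => y; rewrite inE => /orP[/eqP->|/En yn].
      exact: le_trans xm (smono _ _ (leq_maxr _ _)).
    exact: le_trans yn (smono _ _ (leq_maxl _ _)).
  by apply: lt_trans (bs n.+1); have [_] := nextP (s n); apply; eauto.
- move=> a [b0 b0a] lim; split; first by exists b0.
  move=> E Ea e KE; have [b ba Eb] := seq_bound b0a Ea.
  have [c [_ Cc] /andP[bc ca]] := lim b ba.
  by apply: lt_trans ca; apply: (Cc E) => // x /Eb /le_lt_trans; apply.
Qed.

(** Each ordinal owns a countably infinite block [range (u a)], disjoint from the others. A triple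
    goes to the block of the larger of its two ordinals, below which everything is countable. *)
Lemma omega1_coding : exists c : W -> nat -> W -> W, forall a i b a' i' b',
  c a i b = c a' i' b' -> [/\ a = a', i = i' & b = b'].
Proof.
have [a0 _] := omega1_inhabited.
pose P a (f : W -> nat -> W) (v : nat -> W) :=
  injective v /\ forall b, b < a -> forall k l, f b k <> v l.
have [|a f|u uP] := @transfinite_choice _ (fun=> a0) P.
- by move=> a f g v fg [vi h]; split=> // b ba k l; rewrite -fg//; exact: h.
- pose A := \bigcup_(b in [set b | b < a]) range (f b).
  have cA : countable A.
    apply: bigcup_countable => [|b _]; first exact: countable_lt.
    exact: (sub_countable (card_image_le _ _)).
  have iA : infinite_set (~` A).
    move=> fA; apply: uncountable_omega1; rewrite -(setvU A).
    by apply: countableU => //; exact: finite_set_countable.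
  have /infiniteP/card_le_setT_inj[v vi vA] := iA.
  by exists v; split=> // b ba k l e; apply: (vA l); exists b => //; exists k.
- have /all_sig[code codeP] a : {f : W -> nat | {in [set b | b <= a] &, injective f}}.
    exact/cid/countable_injP/countable_le.
  pose m a b : W := Order.max a b.
  exists (fun a i b => u (m a b) (pickle (code (m a b) a, i, code (m a b) b))).
  move=> a i b a' i' b' e.
  have em : m a b = m a' b'.
    case: (ltgtP (m a b) (m a' b')) => // lt.
    - by have [_ /(_ _ lt) h] := uP (m a' b'); case: (h _ _ e).
    - by have [_ /(_ _ lt) h] := uP (m a b); case: (h _ _ (esym e)).
  have [ui _] := uP (m a b).
  have ma : m a b \in [set x | x <= m a b] by rewrite inE /=.
  move: e; rewrite -em => /ui/(pcan_inj pickleK)[ea -> eb]; split=> //.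
  - by apply: codeP ea; rewrite inE /=; [|rewrite em]; rewrite le_max lexx.
  - by apply: codeP eb; rewrite inE /=; [|rewrite em]; rewrite le_max lexx orbT.
Qed.
End Omega1.

(** * Generic functions on Cantor cubes *)

Section Agree.
Context d (W : orderType d).
Implicit Types (a b : W) (y z : W -> bool) (E F : seq W).

Definition agree b y z := forall a, a < b -> y a = z a.
Definition agree_on E y z := {in E, forall a, y a = z a}.
Definition below b E := {in E, forall a, a < b}.

Lemma agreeC b y z : agree b y z -> agree b z y.
Proof. by move=> yz a ab; rewrite yz. Qed.

Lemma agree_trans b y z t : agree b y z -> agree b z t -> agree b y t.
Proof. by move=> yz zt a ab; rewrite yz// zt. Qed.

Lemma agree_le a b y z : a <= b -> agree b y z -> agree a y z.
Proof. by move=> ab yz e ea; apply: yz; exact: lt_le_trans ab. Qed.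

Lemma agree_onC E y z : agree_on E y z -> agree_on E z y.
Proof. by move=> yz a ab; rewrite yz. Qed.

Lemma agree_on_trans E y z t : agree_on E y z -> agree_on E z t -> agree_on E y t.
Proof. by move=> yz zt a ab; rewrite yz// zt. Qed.

Lemma agree_on_sub E F y z : {subset E <= F} -> agree_on F y z -> agree_on E y z.
Proof. by move=> EF yz e /EF; exact: yz. Qed.

Lemma below_cat b E F : below b E -> below b F -> below b (E ++ F).
Proof. by move=> yz yz' e; rewrite mem_cat => /orP[/yz|/yz']. Qed.

Lemma below_le a b E : a <= b -> below a E -> below b E.
Proof. by move=> ab Ea e /Ea /lt_le_trans; apply. Qed.

Lemma agree_below b E y z : below b E -> agree b y z -> agree_on E y z.
Proof. by move=> Eb yz e /Eb; exact: yz. Qed.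

Lemma disagree b y z : ~ agree b y z -> exists2 a, a < b & y a <> z a.
Proof. by move=> /existsNP[a] /not_implyP[ab yz]; exists a. Qed.

Lemma disagree_fun b : exists diff : (W -> bool) -> (W -> bool) -> W,
  forall y z, ~ agree b y z -> diff y z < b /\ y (diff y z) <> z (diff y z).
Proof.
have /choice[f fP] (p : (W -> bool) * (W -> bool)) :
    exists a, ~ agree b p.1 p.2 -> a < b /\ p.1 a <> p.2 a.
  case: (pselect (agree b p.1 p.2)) => [h|/[dup] h /disagree[a ? ?]]; last by exists a.
  by exists b.
by exists (fun y z => f (y, z)) => y z; exact: (fP (y, z)).
Qed.

Lemma separating_coordinates (I : eqType) b (x : W -> bool) (a : I -> W -> bool)
    (J : seq I) :
    {in J &, forall i j, i != j -> ~ agree b (a i) (a j)} ->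
    {in J, forall i, ~ agree b (a i) x} ->
  exists F, [/\ below b F,
    {in J &, forall i j, i != j -> ~ agree_on F (a i) (a j)} &
    {in J, forall i, ~ agree_on F (a i) x}].
Proof.
move=> aa ax; have [diff diffP] := disagree_fun b.
(* [diff] is arbitrary on pairs that agree below [b], for instance when [i = j]; the filter discards
   its values that are not below [b]. *)
exists [seq e <- [seq diff (a i) (a j) | i <- J, j <- J] ++ [seq diff (a i) x | i <- J]
       | e < b]; split.
- by move=> e; rewrite mem_filter => /andP[].
- move=> i j iJ jJ /(aa i j iJ jJ)/diffP[lt ne] /(_ (diff (a i) (a j))) h.
  apply/ne/h; rewrite mem_filter lt mem_cat; apply/orP; left.
  by apply/allpairsP; exists (i, j).
- move=> i iJ; have /diffP[lt ne] := ax i iJ; move=> /(_ (diff (a i) x)) h.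
  by apply/ne/h; rewrite mem_filter lt mem_cat map_f ?orbT.
Qed.

End Agree.

(* The function [f] is the limit of finitely supported approximations, each of
   them deciding one of the countably many requirements [Q t] outside a smaller
   neighbourhood of [x], as in the Rasiowa-Sikorski lemma. *)
Lemma generic_function d (W : orderType d) (hW : is_omega1 W) (b : W)
    (x : W -> bool) (T : countType)
    (Q : T -> set (W -> bool) -> ((W -> bool) -> bool) -> Prop) :
    (forall t Z h, Q t Z h -> exists F, [/\ below b F,
       forall y z, agree_on F y z -> h y = h z &
       forall y, Z y -> ~ agree_on F y x]) ->
  exists f : (W -> bool) -> bool,
  [/\ forall y, ~ agree b y x -> exists E, below b E /\
        forall z, agree_on E y z -> ~ agree b z x /\ f z = f y,
      forall y z, agree b y z -> f y = f z &
      forall t,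
        (forall E, below b E -> exists Z h, Q t Z h /\ forall y, Z y -> agree_on E y x) ->
        exists Z h, Q t Z h /\ forall y, Z y -> f y = h y].
Proof.
move=> tame.
have /countable_injP[code codeP] := countable_lt hW b.
pose prem t := forall E, below b E ->
  exists Z h, Q t Z h /\ forall y, Z y -> agree_on E y x.
pose inv (s : seq W * ((W -> bool) -> bool)) := below b s.1 /\
  forall y z, agree_on s.1 y z -> s.2 y = s.2 z.
(* Stage [n] changes nothing off the box around [x] given by the old support, adds the coordinate
   coded by [n], and settles requirement [n] on a set [Z] that the new support separates from [x];
   later stages respect this decision. *)
pose good n (s s' : seq W * ((W -> bool) -> bool)) :=
  [/\ {subset s.1 <= s'.1},
      forall y, ~ agree_on s.1 y x -> s'.2 y = s.2 y,
      forall e, e < b -> code e = n -> e \in s'.1 &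
      forall t, pickle t = n -> prem t -> exists Z h, Q t Z h /\
        forall y, Z y -> s'.2 y = h y /\ ~ agree_on s'.1 y x].
have /choice[step stepP] (p : nat * (seq W * ((W -> bool) -> bool))) :
    exists s', inv p.2 -> inv s' /\ good p.1 p.2 s'.
  case: p => n [E g] /=.
  have [[Eb gE]|ninv] := pselect (inv (E, g)); last by exists (E, g).
  have [B Bb BP] : exists2 B, below b B & forall e, e < b -> code e = n -> e \in B.
    have [[e [eb en]]|ne] := pselect (exists e, e < b /\ code e = n).
      exists [:: e] => [a|a ab an]; first by rewrite inE => /eqP->.
      by rewrite inE; apply/eqP/codeP; rewrite ?inE//= an en.
    by exists [::] => // e eb en; case: ne; exists e.
  have [[t [tn pt]]|nt] := pselect (exists t, pickle t = n /\ prem t); last first.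
    exists (E ++ B, g) => _; split.
      split; first exact: below_cat.
      by move=> y z yz; apply: gE; apply: agree_on_sub yz => e; rewrite mem_cat => ->.
    split=> //=.
    - by move=> e; rewrite mem_cat => ->.
    - by move=> e eb en; rewrite mem_cat BP ?orbT.
    - by move=> t tn pt; case: nt; exists t.
  have [Z [h [QZ ZE]]] := pt E Eb.
  have [F [Fb hF ZF]] := tame _ _ _ QZ.
  have sE : {subset E <= E ++ F ++ B} by move=> e; rewrite mem_cat => ->.
  have sF : {subset F <= E ++ F ++ B} by move=> e; rewrite !mem_cat => ->; rewrite orbT.
  (* [Z] lies in the old box, where the approximation may still become [h]; with [F] in the support,
     [Z] is outside the new box. *)
  exists (E ++ F ++ B, fun y => if `[<agree_on E y x>] then h y else g y) => _.
  split; [split=> /=|split=> //=].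
  - by apply: below_cat => //; exact: below_cat.
  - move=> y z yz; have yzE := agree_on_sub sE yz.
    have /= -> := gE y z yzE; rewrite (hF y z (agree_on_sub sF yz)).
    by congr (if _ then _ else _); apply/asboolP/asboolP => yx;
      apply: agree_on_trans yx => //; exact: agree_onC.
  - by move=> y; case: asboolP.
  - by move=> e eb en; rewrite !mem_cat BP ?orbT.
  - move=> t' t'n _; have -> : t' = t by apply: (pcan_inj pickleK); rewrite tn.
    exists Z, h; split=> // y Zy; split; first by case: asboolP => // /(_ (ZE y Zy)).
    by move=> /(agree_on_sub sF); exact: ZF.
pose s := fix s n := if n is m.+1 then step (m, s m) else ([::], fun=> false).
have sinv n : inv (s n) by elim: n => [|n /(stepP (n, s n))[]].
have sgood n : good n (s n) (s n.+1) by have [] := stepP (n, s n) (sinv n).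
have stable n m y : (n <= m)%N -> ~ agree_on (s n).1 y x ->
    (s m).2 y = (s n).2 y /\ ~ agree_on (s m).1 y x.
  move=> nm ny; elim: m nm => [|m ih]; first by rewrite leqn0 => /eqP<-.
  rewrite leq_eqVlt => /orP[/eqP<-//|/ih[e ne]].
  have [sub keep _ _] := sgood m; rewrite keep//; split=> //.
  by move=> /(agree_on_sub sub).
(* The value is frozen once [y] leaves the box around [x]. The points that never leave are those
   that agree with [x] below [b]; they get [false]. *)
pose f y := if pselect (exists n, ~ agree_on (s n).1 y x) is left e
  then (s (projT1 (cid e))).2 y else false.
have fE n y : ~ agree_on (s n).1 y x -> f y = (s n).2 y.
  rewrite /f => ny; case: pselect => [e|[]]; last by exists n.
  case: cid => m /= my; have [le|/ltnW le] := leqP n m.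
  - by have [->] := stable _ _ _ le ny.
  - by have [->] := stable _ _ _ le my.
have loc y : ~ agree b y x -> exists n, ~ agree_on (s n).1 y x.
  move=> /disagree[e eb ne]; exists (code e).+1.
  by have [_ _ /(_ e eb erefl) es _] := sgood (code e); move/(_ e es).
have fL y : ~ agree b y x -> exists E, below b E /\
    forall z, agree_on E y z -> ~ agree b z x /\ f z = f y.
  move=> /loc[n ny]; have [sb sn] := sinv n; exists (s n).1; split=> // z yz.
  have nz : ~ agree_on (s n).1 z x by move=> /(agree_on_trans yz).
  by split; [move/(agree_below sb)|rewrite (fE n)// (fE n)// (sn _ _ yz)].
exists f; split=> //.
- move=> y z yz; have [yx|/fL[E [Eb /(_ z)[|_ ->//]]]] := pselect (agree b y x);
    last exact: agree_below yz.
  have no t : agree b t x -> f t = false.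
    rewrite /f => tx; case: pselect => // -[n]; case.
    by apply: agree_below tx; have [] := sinv n.
  by rewrite !no//; apply: agree_trans yx; exact: agreeC.
- move=> t pt; have [_ _ _ /(_ t erefl pt)[Z [h [QZ hZ]]]] := sgood (pickle t).
  by exists Z, h; split=> // y /hZ[<- ne]; exact: fE.
Qed.

(** * The splitting functions *)

Section Threads.
Context d (W : orderType d) (hW : is_omega1 W).
Context (c : W -> nat -> W -> W) (D : W -> W -> bool).
Implicit Types (a b g xi : W) (f : W -> (W -> bool) -> bool) (y : W -> bool).
Implicit Types (E G : seq W) (I L e : seq nat) (B : seq (nat * W * bool)).

(* [D g] codes the tuples [guess g xi] of points of 2^g, for [xi < g]. *)
Definition guess g xi i : W -> bool := fun a => D g (c xi i a).

Definition thread f b y :=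
  forall a, a < b -> ~ agree a y (D a) -> y a = f a y.

(** Finite conditions on the index of a guessed tuple. A triple (i, a, r) in [B] imposes the bit r
    at [a] on all threads up to [b] that extend entry i, so [B] describes a basic neighbourhood that
    the tuple enters however it is extended. *)
Definition candidate f b g L G B I xi :=
  [/\ xi < g,
      {in L &, forall i j, i != j -> ~ agree g (guess g xi i) (guess g xi j)},
      {in G & L, forall eta i, ~ agree g (guess g xi i) (guess g eta i)},
      {in L, forall i, i \in I -> ~ agree g (guess g xi i) (D b)} &
      {in B, forall p y, p.1.1 \in L -> thread f b y ->
         agree g y (guess g xi p.1.1) -> y p.1.2 = p.2}].

(* [v] is continuous off [D b] and, whenever a tuple of the guessed sequence
   clusters at a point some of whose coordinates (those in [I]) are [D b], it
   still clusters there on the prescribed sides of [v]. *)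
Definition splits f b (v : (W -> bool) -> bool) :=
  [/\ forall y, ~ agree b y (D b) -> exists E, below b E /\
        forall z, agree_on E y z -> ~ agree b z (D b) /\ v z = v y,
      forall y z, agree b y z -> v y = v z &
      forall g L G B I e, g <= b -> below g G -> {in B, forall p, p.1.2 < b} ->
        (forall E, below b E -> exists xi, candidate f b g L G B I xi /\
           {in L, forall i y, i \in I -> thread f b y ->
             agree g y (guess g xi i) -> agree_on E y (D b)}) ->
        exists xi, candidate f b g L G B I xi /\
           {in L, forall i y, i \in I -> thread f b y ->
             agree g y (guess g xi i) -> v y = (i \in e)}].

Lemma thread_le f a b y : a <= b -> thread f b y -> thread f a y.
Proof. by move=> ab yb e ea; apply: yb; exact: lt_le_trans ab. Qed.

Lemma thread_local f f' b y : (forall a, a < b -> f a = f' a) ->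
  thread f b y -> thread f' b y.
Proof. by move=> ff yb a ab; rewrite -ff//; exact: yb. Qed.

Lemma splits_local b f f' v : (forall a, a < b -> f a = f' a) ->
  splits f b v -> splits f' b v.
Proof.
move=> ff [v1 v2 v3].
have ff' a : a < b -> f' a = f a by move=> /ff.
have cand g L G B I xi : candidate f' b g L G B I xi <-> candidate f b g L G B I xi.
  by split=> -[? ? ? ? h]; split=> // p pB y pL /[dup] yt /(thread_local _) h';
    apply: h => //; exact: h'.
split=> // g L G B I e gb Gg Bb h.
have [|xi [cxi vxi]] := v3 g L G B I e gb Gg Bb.
  move=> E Eb; have [xi [cxi xiE]] := h E Eb.
  exists xi; split; first exact/cand.
  by move=> i iL y iI yt; apply: (xiE i iL y iI); exact: thread_local yt.
exists xi; split; first exact/cand.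
by move=> i iL y iI yt; apply: (vxi i iL y iI); exact: thread_local yt.
Qed.

(** The parameters in the third clause of [splits] are finite data built from ordinals up to [b],
    hence countably many, and [generic_function] at the point [D b] meets all the requirements at
    once. *)
Lemma splits_exists f b : exists v, splits f b v.
Proof.
have [w [w' wK]] : exists (w : nat -> W) (w' : W -> nat), forall a, a <= b -> w (w' a) = a.
  have /countable_injP[w' w'i] := countable_le hW b.
  have /choice[w wP] n : exists a, (exists2 a', a' <= b & w' a' = n) -> a <= b /\ w' a = n.
    case: (pselect (exists2 a', a' <= b & w' a' = n)) => [[a ? ?]|?]; last by exists b.
    by exists a.
  exists w, w' => a ab; have [|wb e] := wP (w' a); first by exists a.
  by apply: w'i e; rewrite inE.
pose T := (nat * seq nat * seq nat * seq (nat * nat * bool) * seq nat * seq nat)%type.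
pose g_ (t : T) := w t.1.1.1.1.1.
pose L_ (t : T) := t.1.1.1.1.2.
pose G_ (t : T) := map w t.1.1.1.2.
pose B_ (t : T) := map (fun p => (p.1.1, w p.1.2, p.2)) t.1.1.2.
pose I_ (t : T) := t.1.2.
pose e_ (t : T) := t.2.
pose Q (t : T) (Z : set (W -> bool)) (h : (W -> bool) -> bool) :=
  (exists F, [/\ below b F, forall y z, agree_on F y z -> h y = h z &
     forall y, Z y -> ~ agree_on F y (D b)]) /\
  exists xi, [/\ candidate f b (g_ t) (L_ t) (G_ t) (B_ t) (I_ t) xi,
    Z = [set y | thread f b y /\ exists2 i, i \in L_ t & i \in I_ t /\
          agree (g_ t) y (guess (g_ t) xi i)] &
    {in L_ t, forall i y, i \in I_ t ->
       agree (g_ t) y (guess (g_ t) xi i) -> h y = (i \in e_ t)}].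
have [|v [v1 v2 v3]] := @generic_function _ W hW b (D b) T Q; first by move=> t Z h [].
exists v; split=> // g L G B I e gb Gg Bb h.
have := v3 (w' g, L, map w' G, map (fun p => (p.1.1, w' p.1.2, p.2)) B, I, e).
rewrite /Q /g_ /L_ /G_ /B_ /I_ /e_ /= wK//.
rewrite -map_comp map_id_in; last first.
  by move=> x /Gg xg; rewrite /= wK//; apply: ltW; exact: lt_le_trans gb.
rewrite -map_comp map_id_in; last first.
  by move=> [[i x] r] /Bb /= xb; rewrite wK// ltW.
case.
  move=> E Eb; have [xi [cxi xiE]] := h E Eb.
  have [ltxi dist _ nD _] := cxi.
  pose J := [seq i <- L | i \in I].
  (* [F] tells the entries with index in [I] apart from each other and from [D b], so a function
     with support [F] can take the prescribed side near each of them. *)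
  have [||F [Fg FJ FD]] := @separating_coordinates _ W nat g (D b) (guess g xi) J.
  - by move=> i j; rewrite !mem_filter => /andP[_ iL] /andP[_ jL]; exact: dist.
  - by move=> i; rewrite mem_filter => /andP[iI iL]; exact: nD.
  exists [set y | thread f b y /\ exists2 i, i \in L & i \in I /\
          agree g y (guess g xi i)].
  exists (fun y => has (fun i => (i \in e) && `[<agree_on F y (guess g xi i)>]) J).
  split; last first.
    by move=> y [yt [i iL [iI yi]]]; exact: (xiE i iL y iI yt yi).
  split.
    exists F; split; first exact: below_le gb Fg.
    - move=> y z yz; apply: eq_has => i; congr (_ && _).
      by apply/asboolP/asboolP; apply: agree_on_trans => //; exact: agree_onC.
    - move=> y [yt [i iL [iI /(agree_below Fg) yi]]] yD.
      apply: (FD i); first by rewrite mem_filter iI.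
      by apply: agree_on_trans yD; exact: agree_onC.
  exists xi; split=> // i iL y iI /(agree_below Fg) yi.
  apply/hasP/idP => [[j jJ /andP[je /asboolP yj]]|ie].
    have iJ : i \in J by rewrite mem_filter iI.
    have [->//|ij] := eqVneq i j; exfalso; apply: (FJ i j iJ jJ ij).
    by apply: agree_on_trans yj; exact: agree_onC.
  exists i; first by rewrite mem_filter iI.
  by rewrite ie; apply/asboolP.
move=> Z [k [[_ [xi [cxi -> hk]]] vk]]; exists xi; split=> // i iL y iI yt yi.
rewrite vk; first exact: hk yi.
by split=> //; exists i.
Qed.

Lemma splitting_family : exists f, forall b, splits f b (f b).
Proof.
apply: (transfinite_choice hW (fun=> false) (P := fun b f v => splits f b v)).
- by move=> b f f' v ff; exact: splits_local.
- by move=> b f; exact: splits_exists.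
Qed.

(* The guessed tuples still cluster at [x] when their entries are extended to
   threads of length [b] in an arbitrary way. *)
Definition near_guess f g L b (x : nat -> W -> bool) :=
  forall E G, below b E -> below g G -> exists xi, [/\ xi < g,
    {in L &, forall i j, i != j -> ~ agree g (guess g xi i) (guess g xi j)},
    {in G & L, forall eta i, ~ agree g (guess g xi i) (guess g eta i)} &
    {in L, forall i y, thread f b y -> agree g y (guess g xi i) ->
      agree_on E y (x i)}].

Lemma seq_split_last (E : seq W) b : below b E -> E = [::] \/
  exists a, [/\ a < b & {in E, forall x, x <= a}].
Proof.
case: E => [|x E] h; [by left|right].
have xb : x < b by apply: h; rewrite mem_head.
by have [a ab aE] := seq_bound xb h; exists a.
Qed.

(** The new bit at [b] is controlled in two ways: where [x i] differs from [D b] below [b], by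
    continuity of [f b] at [x i]; where it agrees, by the clustering clause of [splits], with the
    side [x i b] prescribed. *)
Lemma near_guess_step f g L b (x : nat -> W -> bool) :
  (forall a, splits f a (f a)) ->
  {in L, forall i, forall a, thread f a (x i)} -> g <= b ->
  near_guess f g L b x -> forall E G, {in E, forall a, a <= b} -> below g G ->
  exists xi, [/\ xi < g,
    {in L &, forall i j, i != j -> ~ agree g (guess g xi i) (guess g xi j)},
    {in G & L, forall eta i, ~ agree g (guess g xi i) (guess g eta i)} &
    {in L, forall i y, thread f b y ->
      (~ agree b y (D b) -> y b = f b y) -> agree g y (guess g xi i) ->
      agree_on E y (x i)}].
Proof.
move=> fs xt gb nx E G Eb Gg.
have [f1 f2 f3] := fs b.
pose I := [seq i <- L | `[<agree b (x i) (D b)>]].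
pose e := [seq i <- I | x i b].
have /choice[E_ E_P] i : exists F, below b F /\ (~ agree b (x i) (D b) ->
    forall z, agree_on F (x i) z -> ~ agree b z (D b) /\ f b z = f b (x i)).
  have [h|h] := pselect (agree b (x i) (D b)); first by exists [::].
  by have [F [? ?]] := f1 _ h; exists F.
(* [C] collects the old demands and the neighbourhoods of continuity; [B] hands them to the
   clustering clause. *)
pose C := [seq a <- E | a < b] ++ flatten [seq E_ i | i <- L].
have Cb : below b C.
  apply: below_cat => [a|a]; first by rewrite mem_filter => /andP[].
  by move=> /flatten_mapP[i _ ai]; have [/(_ _ ai)] := E_P i.
pose B := [seq (i, a, x i a) | i <- L, a <- C].
have [|||xi [[xig dist Gxi Dxi Bxi] fxi]] := f3 g L G B I e gb.
- exact: Gg.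
- by move=> p /allpairsP[[i a]] [_ aC ->] /=; exact: Cb.
- move=> F Fb.
  (* A candidate must differ from [D b] in the entries of [I]. Putting one index [et i] with entry i
     equal to [D b], if there is one, on the list to avoid excludes all such indices. *)
  have /choice[et etP] i : exists eta,
      (exists2 eta, eta < g & agree g (guess g eta i) (D b)) ->
      eta < g /\ agree g (guess g eta i) (D b).
    have [[eta ? ?]|?] := pselect (exists2 eta, eta < g & agree g (guess g eta i) (D b)).
      by exists eta.
    by exists b.
  have [||xi [xig dist Gxi nxi]] := nx (F ++ C) (G ++ [seq eta <- map et L | eta < g]).
  - exact: below_cat.
  - by apply: below_cat => // a; rewrite mem_filter => /andP[].
  have Gsub : {subset G <= G ++ [seq eta <- map et L | eta < g]}.
    by move=> a aG; rewrite mem_cat aG.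
  exists xi; split; [split=> //|].
  - by move=> eta i /Gsub; exact: Gxi.
  - move=> i iL iI xiD; have [lt etD] := etP i (ex_intro2 _ _ xi xig xiD).
    apply: (Gxi (et i) i) => //; first by rewrite mem_cat mem_filter lt map_f ?orbT.
    by apply: agree_trans xiD _; exact: agreeC.
  - move=> p /allpairsP[[i a]] [/= _ aC ->] y /= iL yt yi.
    by apply: (nxi i iL y yt yi); rewrite mem_cat aC orbT.
  - move=> i iL y; rewrite mem_filter => /andP[/asboolP xD _] yt yi a aF.
    rewrite (nxi i iL y yt yi a) ?mem_cat ?aF//.
    by apply: xD; exact: Fb.
exists xi; split=> // i iL y yt yb yi a aE.
have yC : agree_on C y (x i).
  move=> a' a'C; apply: (Bxi (i, a', x i a')) => //.
  by apply/allpairsP; exists (i, a').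
have := Eb a aE; rewrite le_eqVlt => /orP[/eqP->|ab]; last first.
  by apply: yC; rewrite mem_cat mem_filter ab aE.
have [xD|xD] := pselect (agree b (x i) (D b)).
  have iI : i \in I by rewrite mem_filter iL andbT; apply/asboolP.
  (* The guessed entry differs from [D b], so the bit of [y] at [b] is forced to be [f b y], which
     [e] makes equal to [x i b]. *)
  rewrite yb; last first.
    move=> yD; apply: (Dxi i iL iI); apply: agree_trans (agree_le gb yD).
    exact: agreeC.
  by rewrite (fxi i iL y iI yt yi) mem_filter iI andbT.
have [_ /(_ xD y)[|yD fy]] := E_P i.
  apply: agree_onC; apply: agree_on_sub yC => a' a'E.
  by rewrite mem_cat; apply/orP; right; apply/flatten_mapP; exists i.
have [b' bb'] := omega1_gt hW b.
by rewrite yb// fy; symmetry; exact: (xt i iL b').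
Qed.

(** Induction on [b]. A finite [E] below [b] is bounded by some [a < b], so limit stages cost
    nothing and the step at [a] suffices. *)
Lemma near_guess_persists f g L (x : nat -> W -> bool) :
  (forall a, splits f a (f a)) ->
  {in L, forall i, forall a, thread f a (x i)} ->
  near_guess f g L g x -> forall b, g <= b -> near_guess f g L b x.
Proof.
move=> fs xt nx; elim/(well_founded_ind (omega1_wf hW)) => b ih gb E G Eb Gg.
have [E0|[a [ab aE]]] := seq_split_last Eb.
  have [//|xi [? ? ? nxi]] := nx E G _ Gg; first by rewrite E0.
  exists xi; split=> // i iL y yt; apply: nxi => //; exact: thread_le yt.
have [ag|ga] := ltP a g.
  have [|xi [? ? ? nxi]] := nx E G _ Gg; first by move=> e /aE /le_lt_trans; apply.
  by exists xi; split=> // i iL y yt; apply: nxi => //; exact: thread_le yt.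
have [xi [? ? ? nxi]] := near_guess_step fs xt ga (ih a ab ga) aE Gg.
exists xi; split=> // i iL y yt yi; apply: nxi => //; first exact: thread_le (ltW ab) yt.
by move=> yD; exact: yt.
Qed.

End Threads.

(** * Threads *)

Lemma countable_mem (T : eqType) (s : seq T) : countable [set` s].
Proof. exact/finite_set_countable/finite_seq. Qed.

Section FullThreads.
Context d (W : orderType d) (hW : is_omega1 W).
Context (c : W -> nat -> W -> W).
Hypothesis cI : forall a i b a' i' b',
  c a i b = c a' i' b' -> [/\ a = a', i = i' & b = b'].
Context (S : W -> set W) (hS : diamond_sequence S).

Let D b : W -> bool := fun x => x \in S b.

Context (f : W -> (W -> bool) -> bool).
Hypothesis fS : forall a, splits c D f a (f a).
Implicit Types (a b g xi : W) (y p q : W -> bool).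

Definition full_thread y := forall b, thread D f b y.

Lemma full_threadP y : full_thread y <-> forall a, ~ agree a y (D a) -> y a = f a y.
Proof.
split=> h a; last by move=> b _; exact: h.
by have [b ab] := omega1_gt hW a; exact: (h b a ab).
Qed.

Lemma guessed y a : exists2 b, a < b & agree b y (D b).
Proof.
have [b [yS Kb]] :=
  @diamond_reflection _ W hW S (fun=> [set a]) [set x | y x] hS (fun=> countable1 a).
exists b; first exact: (Kb [::]).
move=> x xb; rewrite /D -yS.
by apply/idP/idP; rewrite inE; [split|case].
Qed.

(** [q] follows [p] up to a stage [b] where [p] is guessed, so that the bit is free, flips it there
    and then obeys [f]. *)
Lemma full_thread_split p a : full_thread p ->
  exists q, [/\ full_thread q, agree a q p & q <> p].
Proof.
move=> /full_threadP pf; have [b ab pD] := guessed p a.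
have f2 e y z : agree e y z -> f e y = f e z by have [_ + _] := fS e; exact.
have [||q qP] := transfinite_choice hW false (P := fun e q v =>
  [/\ e < b -> v = p e, e = b -> v = ~~ p b &
      b < e -> ~ agree e q (D e) -> v = f e q]).
- move=> e q q' v qq' [v1 v2 v3]; split=> // be q'D; rewrite v3//; first exact: f2.
  by move=> qD; apply: q'D => x xe; rewrite -qq'// qD.
- move=> e q; have [eb|be|->] := ltgtP e b.
  + by exists (p e); split=> // e'; move: eb; rewrite e' ltxx.
  + by exists (f e q); split=> // e'; move: be; rewrite e' ltxx.
  + by exists (~~ p b).
have qp : agree b q p by move=> x xb; have [+ _ _] := qP x; exact.
exists q; split.
- apply/full_threadP => e qD; have [eb|be|eb] := ltgtP e b.
  + rewrite qp// pf; first by apply/f2/agreeC/(agree_le (ltW eb)).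
    by move=> pD'; apply: qD; apply: agree_trans pD'; exact: (agree_le (ltW eb)).
  + by have [_ _] := qP e; exact.
  + by case: qD; rewrite eb; exact: agree_trans pD.
- by apply: agree_le qp; exact: ltW.
- by move=> qp'; have [_ /(_ erefl)] := qP b; rewrite qp'; case: (p b).
Qed.

(* Each [y] meets [S] uncountably often; the bit chosen at the splitting stage
   number [xi] along [y] is [s xi]. *)
Lemma full_thread_embedding : exists F : (W -> bool) -> W -> bool,
  injective F /\ forall s, full_thread (F s).
Proof.
have [a0 _] := omega1_inhabited hW.
have f2 e y z : agree e y z -> f e y = f e z by have [_ + _] := fS e; exact.
(* The second component numbers the splitting stages along the path: it is the least index not yet
   taken, and the bit is the entry of [s] at that index. *)
pose P (s : W -> bool) e (h : W -> bool * W) (v : bool * W) :=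
  [/\ ~ agree e (fst \o h) (D e) -> v.1 = f e (fst \o h),
      agree e (fst \o h) (D e) -> v.1 = s v.2,
      agree e (fst \o h) (D e) ->
        forall e', e' < e -> agree e' (fst \o h) (D e') -> (h e').2 <> v.2 &
      agree e (fst \o h) (D e) -> forall x, x < v.2 -> exists e',
        [/\ e' < e, agree e' (fst \o h) (D e') & (h e').2 = x]].
have ex s : exists h, forall e, P s e h (h e).
  apply: (transfinite_choice hW (false, a0) (P := P s)).
  - move=> e h h' v hh'.
    have hh : agree e (fst \o h) (fst \o h') by move=> x xe; rewrite /= hh'.
    have iff e' : e' <= e -> agree e' (fst \o h') (D e') -> agree e' (fst \o h) (D e').
      by move=> le; apply: agree_trans; exact: agree_le hh.
    have iff' e' : e' <= e -> agree e' (fst \o h) (D e') -> agree e' (fst \o h') (D e').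
      by move=> le; apply: agree_trans; apply: agreeC; exact: agree_le hh.
    case=> v1 v2 v3 v4; split.
    + move=> n; rewrite v1; first exact: f2.
      by move=> m; apply: n; exact: iff'.
    + by move=> m; apply/v2/iff.
    + move=> m e' e'e m'; rewrite -hh'//; apply: v3 => //; first exact: iff.
      by apply: iff => //; exact: ltW.
    + move=> m x /v4[|e' [e'e m' e'x]]; first exact: iff.
      by exists e'; rewrite -hh'//; split=> //; apply: iff' => //; exact: ltW.
  - move=> e h; have [m|n] := pselect (agree e (fst \o h) (D e)); last first.
      by exists (f e (fst \o h), a0).
    pose used := [set x | exists e',
        [/\ e' < e, agree e' (fst \o h) (D e') & (h e').2 = x]].
    have cu : countable used.
      apply: (sub_countable (B := (snd \o h) @` [set e' | e' < e])).
        by apply: subset_card_le => x [e' [? _ <-]]; exists e'.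
      apply: sub_countable (countable_lt hW e); exact: card_image_le.
    have [|x ux xmin] := @omega1_min _ _ hW (~` used).
      have [b bP] := omega1_bounded hW cu.
      by exists b => /bP; rewrite ltxx.
    exists (s x, x); split=> //=.
      by move=> _ e' e'e m' e'x; apply: ux; exists e'.
    move=> _ z zx; apply: contrapT => nz.
    by have := xmin z nz; rewrite leNgt zx.
have /choice[h hP] := ex.
exists (fun s => fst \o h s); split; last first.
  move=> s; apply/full_threadP => e n; have [+ _ _ _] := hP s e.
  exact.
move=> s s' e_y; set y := fst \o h s.
have hP' e : P s' e (h s') (h s' e) := hP s' e.
have yE : fst \o h s' = y by [].
(* The numbering depends only on [y], not on the sequence coded in it. *)
have idx e : agree e y (D e) -> (h s e).2 = (h s' e).2.
  elim/(well_founded_ind (omega1_wf hW)): e => e ih m.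
  have [_ _ h3 h4] := hP s e; have [_ _ h3' h4'] := hP s' e.
  rewrite yE in h3' h4'.
  case: (ltgtP (h s e).2 (h s' e).2) => // lt.
  - have [e' [e'e m' e'x]] := h4' m _ lt.
    by case: (h3 m e' e'e m'); rewrite ih.
  - have [e' [e'e m' e'x]] := h4 m _ lt.
    by case: (h3' m e' e'e m'); rewrite -ih.
apply/funext => x; apply: contrapT => ne.
(* If the index [x] were never reached, the splitting stages along [y] would inject into the
   ordinals below [x] and be bounded, against [guessed]. *)
have [e [m ex']] : exists e, agree e y (D e) /\ (h s e).2 = x.
  apply: contrapT => nx.
  have lt e : agree e y (D e) -> (h s e).2 < x.
    move=> m; case: ltgtP => // lt; last by case: nx; exists e.
    have [_ _ _ /(_ m _ lt)[e' [_ m' e'x]]] := hP s e.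
    by case: nx; exists e'.
  have : countable [set e | agree e y (D e)].
    have /countable_injP[k ki] := countable_lt hW x.
    apply/countable_injP; exists (k \o (snd \o h s)) => e e'.
    rewrite !inE /= => m m' /ki; rewrite !inE => /(_ (lt _ m) (lt _ m')) ee'.
    have [_ _ h3 _] := hP s e; have [_ _ h3' _] := hP s e'.
    case: (ltgtP e e') => // l.
    - by case: (h3' m' e l m).
    - by case: (h3 m e' l m').
  move=> /(omega1_bounded hW)[b bP].
  by have [e be /bP] := guessed y b; rewrite ltNge ltW.
have [_ /(_ m) h2 _ _] := hP s e; have [_ + _ _] := hP s' e.
rewrite yE => /(_ m) h2'; apply: ne.
by rewrite -ex' -h2 idx// -h2' -/((fst \o h s) e) e_y.
Qed.

(** The sequence of tuples is coded through [c] as one subset of [W] and guessed at an ordinal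
    closed under [c] and [K]; closure under [c] keeps the codes of all bits below [g] within the
    guess. *)
Lemma diamond_guess (a : W -> nat -> W -> bool) (K : seq W -> set W) :
    (forall E, countable (K E)) ->
  exists g, [/\ forall E, below g E -> forall b, K E b -> b < g &
    forall xi i, xi < g -> agree g (guess c D g xi i) (a xi i)].
Proof.
move=> cK.
pose K' E := K E `|` \bigcup_(x in [set` E]) \bigcup_(z in [set` E]) range (c x ^~ z).
have [|g [gS Kg]] := @diamond_reflection _ W hW S K'
    [set z | exists x i b, z = c x i b /\ a x i b] hS.
  move=> E; apply: countableU => //.
  apply: bigcup_countable => [|x _]; first exact: countable_mem.
  apply: bigcup_countable => [|z _]; first exact: countable_mem.
  exact: (sub_countable (card_image_le _ _)).
exists g; split=> [E Eg b KE|xi i xig b bg].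
  by apply: (Kg E Eg); left.
have cg : c xi i b < g.
  apply: (Kg [:: xi; b]).
    by move=> x; rewrite !inE => /orP[] /eqP->.
  right; exists xi; first by rewrite /= !inE eqxx.
  exists b; first by rewrite /= !inE eqxx orbT.
  by exists i.
rewrite /guess /D -gS; apply/idP/idP; rewrite inE.
  by case=> -[x [j [b' [/cI[-> -> ->]]]]].
by move=> axb; split=> //; exists xi, i, b.
Qed.

Lemma difference : exists diff : (W -> bool) -> (W -> bool) -> W,
  forall y z, y <> z -> y (diff y z) <> z (diff y z).
Proof.
have [a0 _] := omega1_inhabited hW.
have /choice[h hP] (p : (W -> bool) * (W -> bool)) :
    exists a, p.1 <> p.2 -> p.1 a <> p.2 a.
  case: (pselect (exists a, p.1 a <> p.2 a)) => [[a ?]|n]; first by exists a.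
  exists a0 => ne; exfalso; apply: ne; apply/funext => x; apply: contrapT => ne.
  by apply: n; exists x.
by exists (fun y z => h (y, z)) => y z; exact: (hP (y, z)).
Qed.

Lemma exists_above a (E : seq W) : exists2 b, a <= b & below b E.
Proof.
elim: E => [|x E [b ab bE]]; first by exists a.
have [e] := omega1_gt hW (Order.max x b); rewrite gt_max => /andP[xe be].
exists e; first by rewrite (le_trans ab)// ltW.
by move=> z; rewrite inE => /orP[/eqP->//|/bE zb]; exact: lt_trans be.
Qed.

(** Once the sequence is guessed at [g], its clustering at [p] concerns only the restriction of [p]
    to [g], and it persists for every thread with that restriction; [full_thread_split] gives one
    other than [p]. *)
Lemma no_unique_limit p (t : nat -> W -> bool) :
    full_thread p -> (forall k, full_thread (t k)) -> (forall k, t k <> p) ->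
    (forall E, exists k, agree_on E (t k) p) ->
  exists q, [/\ full_thread q, q <> p &
    forall E, exists k, t k <> q /\ agree_on E (t k) q].
Proof.
move=> pf tf tp lim; have [diff diffP] := difference.
have [j ji] : exists j : nat -> W, injective j.
  have : infinite_set [set: W].
    by move=> /finite_set_countable; exact: uncountable_omega1.
  by move=> /infiniteP/card_le_setT_inj[j ji _]; exists j.
have /choice[k kP] xi : exists k, forall l, j l = xi -> k = l.
  case: (pselect (exists l, j l = xi)) => [[l <-]|n]; last first.
    by exists 0%N => l jl; case: n; exists l.
  by exists l => m /ji.
(* Closure under [K] places all terms of the sequence at indices below [g] and makes each differ
   from [p] below [g]. *)
pose K (E : seq W) := range j `|` [set diff p (t (k xi)) | xi in [set` E]].
have [|g [Kg gg]] := @diamond_guess (fun xi _ => t (k xi)) K.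
  move=> E; apply: countableU; first exact: (sub_countable (card_image_le _ _)).
  by apply: sub_countable (card_image_le _ _) _; exact: countable_mem.
have jg l : j l < g by apply: (Kg [::]) => //; left; exists l.
have dg xi : xi < g -> diff p (t (k xi)) < g.
  move=> xig; apply: (Kg [:: xi]); first by move=> x; rewrite inE => /eqP->.
  by right; exists xi => //=; rewrite inE.
have dP xi : p (diff p (t (k xi))) <> t (k xi) (diff p (t (k xi))).
  by apply: diffP => e; exact: (tp (k xi)).
have [q [qf qp qnp]] := full_thread_split g pf.
have nq : near_guess c D f g [:: 0%N] g (fun=> q).
  move=> E G Eg Gg.
  (* Agreement with [p] also where the terms indexed by [G] leave [p] makes the new term different
     from them. *)
  have [l lE] := lim (E ++ [seq diff p (t (k eta)) | eta <- G]).
  have kj : k (j l) = l by exact: kP.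
  have jgu i : agree g (guess c D g (j l) i) (t l) by rewrite -{2}kj; exact: gg.
  exists (j l); split=> //.
  - by move=> i i'; rewrite !inE => /eqP-> /eqP->.
  - move=> eta i /[dup] etaG /Gg etag _ /(_ _ (dg _ etag)).
    rewrite (jgu _ _ (dg _ etag)) (gg _ i etag _ (dg _ etag)) => h.
    by apply: (dP eta); rewrite -h -lE// mem_cat map_f ?orbT.
  - move=> i _ y yf yg a aE; rewrite yg ?Eg// jgu ?Eg// lE ?mem_cat ?aE//.
    by rewrite qp ?Eg.
exists q; split=> // E.
have [b gb bE] := exists_above g E.
have [//||xi [xig _ _ xiP]] :=
  near_guess_persists hW fS (fun i _ a => qf a) nq gb (E := E) (G := [::]) => //.
exists (k xi); split.
  move=> e; apply: (dP xi); rewrite e -qp//.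
  by rewrite -e; exact: dg.
apply: (xiP 0%N); rewrite ?mem_head//; first exact: tf.
exact/agreeC/gg.
Qed.

(** Induction on the number of coordinates. A coordinate that is constant, or equal to another one,
    on uncountably many indices is dropped. Otherwise the sequence is thinned to one without
    repeated entries and guessed at some [g], and its term [g] is a limit of the earlier ones. *)
Lemma no_left_separated (L : seq nat) (a : W -> nat -> W -> bool) :
    (forall xi, {in L, forall i, full_thread (a xi i)}) ->
  exists xi, forall E, exists2 eta, eta < xi &
    {in L, forall i, agree_on E (a eta i) (a xi i)}.
Proof.
have [n] := ubnP (size L); elim: n => // n ih in L a *; rewrite ltnS => Ln af.
have drop (i : nat) U : i \in L -> ~ countable U ->
    (forall xi eta, U xi -> U eta -> forall E,
       {in [seq j <- L | j != i], forall j, agree_on E (a eta j) (a xi j)} ->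
       agree_on E (a eta i) (a xi i)) ->
    exists xi, forall E, exists2 eta, eta < xi &
      {in L, forall i, agree_on E (a eta i) (a xi i)}.
  move=> iL ncU Ui.
  have [h [hU hlt]] := thinning hW (bad := fun=> set0) ncU (fun=> @countable0 _).
  have [||xi xiP] := ih [seq j <- L | j != i] (a \o h).
  - apply: leq_trans Ln; rewrite size_filter -(count_predC (fun j => j != i)) -addn1.
    by rewrite leq_add2l -has_count; apply/hasP; exists i; rewrite //= eqxx.
  - by move=> xi j; rewrite mem_filter => /andP[_]; exact: af.
  exists (h xi) => E; have [eta lt etaP] := xiP E.
  exists (h eta); first by have [] := hlt _ _ lt.
  move=> j jL; have [->|ji] := eqVneq j i; first exact: Ui.
  by apply: etaP; rewrite mem_filter ji.
have [[i [z [iL ncz]]]|cz] :=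
    pselect (exists i z, i \in L /\ ~ countable [set xi | a xi i = z]).
  by apply: (drop i _ iL ncz) => xi eta /= -> -> E _.
have {}cz i z : i \in L -> countable [set xi | a xi i = z].
  by move=> iL; apply: contrapT => ?; apply: cz; exists i, z.
have [[i [j [iL jL ij ncij]]]|cij] := pselect (exists i j,
    [/\ i \in L, j \in L, i != j & ~ countable [set xi | a xi i = a xi j]]).
  apply: (drop i _ iL ncij) => xi eta /= -> -> E; apply.
  by rewrite mem_filter eq_sym ij.
have {}cij i j : i \in L -> j \in L -> i != j -> countable [set xi | a xi i = a xi j].
  by move=> iL jL ij; apply: contrapT => ?; apply: cij; exists i, j.
pose U := [set xi | {in L &, forall i j, i != j -> a xi i <> a xi j}].
pose bad eta := [set xi | exists i j, [/\ i \in L, j \in L & a xi i = a eta j]].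
have ncU : ~ countable U.
  move=> cU; apply: (uncountable_omega1 hW).
  apply: (sub_countable (B := U `|` \bigcup_(i in [set` L])
     \bigcup_(j in [set` [seq j <- L | i != j]]) [set xi | a xi i = a xi j])).
    apply: subset_card_le => xi _; have [Ux|nU] := pselect (U xi); [by left|right].
    apply: contrapT => nb; apply: nU => i j iL jL ij e; apply: nb.
    by exists i => //; exists j; rewrite //= mem_filter ij.
  apply: countableU => //; apply: bigcup_countable => [|i iL]; first exact: countable_mem.
  apply: bigcup_countable => [|j]; first exact: countable_mem.
  by rewrite /= mem_filter => /andP[? ?]; exact: cij.
have [|h [hU hlt]] := @thinning _ _ hW U bad ncU.
  move=> eta; apply: (sub_countable (B := \bigcup_(i in [set` L])
     \bigcup_(j in [set` L]) [set xi | a xi i = a eta j])).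
    by apply: subset_card_le => xi [i [j [iL jL e]]]; exists i => //; exists j.
  apply: bigcup_countable => [|i iL]; first exact: countable_mem.
  by apply: bigcup_countable => [|j _]; [exact: countable_mem|exact: cz].
have [diff diffP] := difference.
pose sat (B : seq (nat * W * bool)) xi :=
  {in B, forall r, r.1.1 \in L -> a (h xi) r.1.1 r.1.2 = r.2}.
(* A Skolem function: it finds an index outside a finite list whose tuple meets a finite condition.
   Since [g] will be closed under it, conditions met by term [g] are met by earlier terms. *)
have /choice[w wP] (BG : seq (nat * W * bool) * seq W) : exists xi,
    (exists2 xi, xi \notin BG.2 & sat BG.1 xi) -> xi \notin BG.2 /\ sat BG.1 xi.
  have [[xi ? ?]|?] := pselect (exists2 xi, xi \notin BG.2 & sat BG.1 xi).
    by exists xi.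
  by have [xi _] := omega1_inhabited hW; exists xi.
pose coords (E : seq W) :=
  [set B : seq (nat * W * bool) | {in B, forall r, r.1.2 \in E}].
pose subs (E : seq W) := [set G : seq W | {in G, forall x, x \in E}].
pose K (E : seq W) :=
  [set w BG | BG in coords E `*` subs E] `|`
  \bigcup_(x in [set` E]) \bigcup_(z in [set` E])
     [set diff (a (h x) ij.1) (a (h z) ij.2) | ij in [set: nat * nat]].
have [|g [Kg gg]] := @diamond_guess (a \o h) K.
  move=> E; apply: countableU.
    apply: sub_countable (card_image_le _ _) _; apply: countableX.
      apply: countable_seq_sub.
      apply: (sub_countable (B := [set: nat] `*` [set` E] `*` [set: bool])).
        by apply: subset_card_le => p /= ?; split.
      by apply: countableX => //; apply: countableX => //; exact: countable_mem.
    by apply: countable_seq_sub; exact: countable_mem.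
  apply: bigcup_countable => [|x _]; first exact: countable_mem.
  apply: bigcup_countable => [|z _]; first exact: countable_mem.
  exact: (sub_countable (card_image_le _ _)).
have wg B G : {in B, forall r, r.1.2 < g} -> below g G -> w (B, G) < g.
  move=> Bg Gg; apply: (Kg (map (fun r => r.1.2) B ++ G)).
    by apply: below_cat => // x /mapP[p /Bg ? ->].
  left; exists (B, G) => //; split=> /= [r rB|x xG].
    by rewrite mem_cat; apply/orP; left; apply/mapP; exists r.
  by rewrite mem_cat xG orbT.
have dg x i z j : x < g -> z < g -> a (h x) i <> a (h z) j ->
    ~ agree g (guess c D g x i) (guess c D g z j).
  move=> xg zg /diffP ne e.
  have lt : diff (a (h x) i) (a (h z) j) < g.
    apply: (Kg [:: x; z]); first by move=> y; rewrite !inE => /orP[] /eqP->.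
    right; exists x; first by rewrite /= !inE eqxx.
    by exists z; [rewrite /= !inE eqxx orbT|exists (i, j)].
  by apply: ne; have := e _ lt; rewrite !gg.
have hinj x i z j : i \in L -> j \in L -> x != z -> a (h x) i <> a (h z) j.
  move=> iL jL xz e; case: (ltgtP x z) xz => // lt _.
  - by have [_ []] := hlt _ _ lt; exists j, i.
  - by have [_ []] := hlt _ _ lt; exists i, j.
have near : near_guess c D f g L g (a (h g)).
  move=> E G Eg Gg.
  pose B := [seq (i, x, a (h g) i x) | i <- L, x <- E].
  have Bg : {in B, forall r, r.1.2 < g}.
    by move=> p /allpairsP[[i x]] [/= _ /Eg ? ->].
  (* The index [g] itself shows that the condition can be met outside [G], as [G] lies below [g]. *)
  have [|wG wB] := wP (B, G).
    exists g; first by apply/negP => /Gg; rewrite ltxx.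
    by move=> p /allpairsP[[i x]] [/= _ _ ->].
  exists (w (B, G)); split.
  - exact: wg.
  - by move=> i j iL jL ij; apply: dg; [exact: wg|exact: wg|exact: hU].
  - move=> eta i etaG iL; apply: dg; [exact: wg|exact: Gg|apply: hinj => //].
    by apply/eqP => e; move: wG; rewrite /= e etaG.
  - move=> i iL y _ yg x xE; rewrite yg ?Eg// gg; [|exact: wg|exact: Eg].
    by apply: (wB (i, x, a (h g) i x)) => //; apply/allpairsP; exists (i, x).
exists (h g) => E; have [b gb bE] := exists_above g E.
have [//||xi [xig _ _ xiP]] :=
  near_guess_persists hW fS (fun i iL e => af (h g) i iL e) near gb (E := E) (G := [::]) => //.
exists (h xi); first by have [] := hlt _ _ xig.
by move=> i iL; apply: (xiP i iL) => //; [exact: af|exact/agreeC/gg].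
Qed.

End FullThreads.

(** * Function spaces *)

Lemma filter_seq (T : Type) (J : eqType) (F : set_system T) (s : seq J) (P : J -> set T) :
  Filter F -> {in s, forall j, F (P j)} -> F [set x | {in s, forall j, P j x}].
Proof.
move=> FF; elim: s => [_|j s ih h].
  by apply: filterS (filterT : F setT) => x _.
have Fj : F (P j) by apply: h; rewrite mem_head.
have Fs : F [set x | {in s, forall j, P j x}].
  by apply: ih => i si; apply: h; rewrite inE si orbT.
apply: filterS (filterI Fj Fs) => x [xj xs] i.
by rewrite inE => /orP[/eqP->|/xs].
Qed.

(** * Basic neighbourhoods for pointwise convergence *)

Section Pointwise.
Context (I : choiceType) (T : topologicalType).
Implicit Types (F G : {ptws I -> T}).

(** The sets containing a finite box around [F] form a filter. It converges to [F], since
    convergence in a supremum of topologies is checked one coordinate at a time. *)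
Lemma ptws_nbhs_box F (A : set {ptws I -> T}) : nbhs F A ->
  exists (s : seq I) (U : I -> set T), (forall i, nbhs (F i) (U i)) /\
    forall G, {in s, forall i, U i (G i)} -> A G.
Proof.
pose FF : set_system {ptws I -> T} := [set A | exists (s : seq I) (U : I -> set T),
  (forall i, nbhs (F i) (U i)) /\ forall G, {in s, forall i, U i (G i)} -> A G].
suff : FF --> F by apply.
have FFF : Filter FF.
  split.
  - by exists [::], (fun=> setT); split=> // i; exact: filterT.
  - move=> B C [s [U [sU UB]]] [t [V [tV VC]]].
    exists (s ++ t), (fun i => U i `&` V i); split; first by move=> i; exact: filterI.
    move=> G GUV; split; [apply: UB|apply: VC] => i iI.
    + by have [] := GUV i; rewrite ?mem_cat ?iI.
    + by have [] := GUV i; rewrite ?mem_cat ?iI ?orbT.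
  - by move=> B C BC [s [U [sU UB]]]; exists s, U; split=> // G /UB /BC.
apply/cvg_sup => i B [_ [[C oC <-] /= CFi] sCB].
exists [:: i], (fun j => [set x | j = i -> C x]); split.
  move=> j; have [->|ji] := eqVneq j i.
    by apply: filterS (open_nbhs_nbhs (conj oC CFi)) => x /=.
  by apply: filterS filterT => x _ /= e; rewrite e eqxx in ji.
by move=> G /(_ i) Gi; apply: sCB; apply: Gi; rewrite ?mem_head.
Qed.

Lemma ptws_eval_continuous (i : I) : continuous (fun F : {ptws I -> T} => F i).
Proof. exact: (@proj_continuous I (fun=> T)). Qed.

End Pointwise.

(** * Subspaces as types *)

Section Subtype.
Context (X : topologicalType) (A : set X).

Lemma sub_nbhs (x : A) (U : set A) : nbhs x U ->
  exists2 V, nbhs (set_val x) V & forall y : A, V (set_val y) -> U y.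
Proof.
move=> [_ [[V oV <-] Vx] VU]; exists V; first exact: open_nbhs_nbhs.
by move=> y; exact: VU.
Qed.

Lemma set_val_continuous : continuous (set_val : A -> X).
Proof. exact: initial_continuous. Qed.

Definition in_sub (x : X) (Ax : A x) : A := SigSub (mem_set Ax).

Lemma in_subK (x : X) (Ax : A x) : set_val (in_sub Ax) = x.
Proof. by rewrite set_valE. Qed.

Lemma sub_valP (x : A) : A (set_val x).
Proof. by rewrite set_valE; exact/set_mem/valP. Qed.

Lemma sub_val_inj : injective (set_val : A -> X).
Proof. by move=> x y; rewrite set_valE; exact: val_inj. Qed.

Lemma compact_sub : compact A -> compact [set: A].
Proof.
move=> cA F PF _.
have [|x [Ax xF]] := cA (set_val @ F) _.
  by rewrite /fmap /=; apply: filterS (filterT : F setT) => x _; exact: (sub_valP x).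
exists (in_sub Ax); split=> // B U FB /sub_nbhs[V].
rewrite in_subK => xV VU.
have [|y [[b Bb <-] Vy]] := xF (set_val @` B) V _ xV.
  by rewrite /fmap /=; apply: filterS FB => b Bb; exists b.
by exists b; split=> //; exact: VU.
Qed.

Lemma separable_sub :
  (exists D, [/\ D `<=` A, countable D & forall O, open O -> O `&` A !=set0 ->
     O `&` D !=set0]) <-> separable A.
Proof.
split=> [[D [DA cD dD]]|[D cD dD]].
- exists (set_val @^-1` D).
    move: cD => /countable_injP[g gi]; apply/countable_injP.
    exists (g \o set_val) => x y; rewrite !inE /= => Dx Dy /gi.
    by rewrite !inE => /(_ Dx Dy)/sub_val_inj.
  move=> O [y Oy] [V oV VO]; have Vy : V (set_val y) by rewrite -VO in Oy.
  have [|x [Vx Dx]] := dD V oV; first by exists (set_val y); split=> //; exact: sub_valP.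
  exists (in_sub (DA x Dx)); split; last by rewrite /= in_subK.
  by rewrite -VO /= in_subK.
- exists (set_val @` D); split.
  + by move=> _ [x _ <-]; exact: sub_valP.
  + by apply: sub_countable cD; exact: card_image_le.
  + move=> O oO [x [Ox Ax]].
    have [||y [Oy Dy]] := dD (set_val @^-1` O); last by exists (set_val y); split=> //; exists y.
      by exists (in_sub Ax); rewrite /= in_subK.
    by exists O.
Qed.

End Subtype.

Lemma separated_hausdorff (X : topologicalType) :
  (forall x y : X, x <> y -> exists (Z : topologicalType) (h : X -> Z),
     [/\ hausdorff_space Z, continuous h & h x <> h y]) ->
  hausdorff_space X.
Proof.
move=> sep x y xy; apply: contrapT => /sep[Z [h [hZ ch hxy]]]; apply: hxy.
apply: hZ => U V hU hV.
have [z [Uz Vz]] := xy _ _ (ch x U hU) (ch y V hV).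
by exists (h z).
Qed.

(** Take a cluster point of the filter of sets containing all but finitely many points of [B];
    removing that point from [B] leaves a member of the filter. *)
Lemma infinite_limit_point (X : topologicalType) (B : set X) :
  compact [set: X] -> infinite_set B -> limit_point B !=set0.
Proof.
move=> cX iB.
pose F : set_system X := [set U | finite_set (B `\` U)].
have PF : ProperFilter F.
  split; first by rewrite /F /= setD0.
  split.
  - by rewrite /F /= setDT; exact: finite_set0.
  - by move=> U V fU fV; rewrite /F /= setDIr; rewrite finite_setU.
  - by move=> U V UV; apply: sub_finite_set; exact: setDS.
have [x [_ xF]] := cX F _ filterT.
exists x => U xU.
have [|y [[By yx] Uy]] := xF (B `\ x) U _ xU.
  rewrite /F /= setDD; apply: (@sub_finite_set _ _ [set x]); last exact: finite_set1.
  by move=> z [].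
by exists y; split=> //; exact/eqP.
Qed.

(** * The function space and its evaluations *)

Section Cp.
Context (R : realType) (X : topologicalType).

Definition Cp_mk (h : X -> R) (ch : continuous h) : Cp R X :=
  @in_sub _ [set f : {ptws X -> R} | continuous (f : X -> R)] h ch.

Definition Cp_val (f : Cp R X) : X -> R := set_val f.

Lemma Cp_valK (h : X -> R) (ch : continuous h) : Cp_val (Cp_mk ch) = h.
Proof. by rewrite /Cp_val /Cp_mk in_subK. Qed.

Lemma Cp_val_continuous (f : Cp R X) : continuous (Cp_val f).
Proof. exact: sub_valP f. Qed.

Lemma Cp_val_inj : injective Cp_val.
Proof. exact: sub_val_inj. Qed.

Lemma Cp_eval_continuous (x : X) : continuous (fun f : Cp R X => Cp_val f x).
Proof.
move=> f; apply: (@continuous_comp _ _ _ (@set_val _ _) (fun g : {ptws X -> R} => g x)).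
  exact: set_val_continuous.
exact: ptws_eval_continuous.
Qed.

Lemma Cp_nbhs (f : Cp R X) (U : set (Cp R X)) : nbhs f U ->
  exists (s : seq X) (V : X -> set R), (forall x, nbhs (Cp_val f x) (V x)) /\
    forall g, {in s, forall x, V x (Cp_val g x)} -> U g.
Proof.
move=> /sub_nbhs[N /ptws_nbhs_box[s [V [fV VN]]] NU].
by exists s, V; split=> // g gV; apply/NU/VN.
Qed.

Lemma Cp_hausdorff : hausdorff_space (Cp R X).
Proof.
apply: separated_hausdorff => f g fg.
have [x ne] : exists x, Cp_val f x <> Cp_val g x.
  apply: contrapT => n; apply/fg/Cp_val_inj/funext => x.
  by apply: contrapT => ne; apply: n; exists x.
exists R, (fun f => Cp_val f x); split=> //; exact: Cp_eval_continuous.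
Qed.

End Cp.

(* Evaluation embeds [X] into [Cp R (Cp R X)]; the image of the complement of
   [p] is countably compact in itself but not closed. *)
Lemma not_Grothendieck_Cp (R : realType) (X : topologicalType) (p : X) :
    (forall x y : X, x <> y -> exists2 h : X -> R, continuous h & h x <> h y) ->
    limit_point [set: X] p ->
    (forall B : set X, ~ B p -> infinite_set B ->
       exists2 q, q <> p & limit_point B q) ->
  ~ Grothendieck_space R (Cp R X).
Proof.
move=> sep lp cc.
pose ev (x : X) : Cp R (Cp R X) := Cp_mk (@Cp_eval_continuous R X x).
have evE x g : Cp_val (ev x) g = Cp_val g x by rewrite Cp_valK.
have ev_inj : injective ev.
  move=> x y e; apply: contrapT => /sep[h ch]; apply.
  by rewrite -(Cp_valK ch) -!evE e.
have ev_cont : continuous ev.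
  move=> x U /Cp_nbhs[s [V [xV VU]]].
  have : nbhs x [set y | {in s, forall g, V g (Cp_val g y)}].
    apply: filter_seq => g _; apply: (Cp_val_continuous (f := g)).
    by have := xV g; rewrite evE.
  by apply: filterS => y ys; apply: VU => g gs; rewrite evE; exact: ys.
pose A := [set ev x | x in ~` [set p]].
(* The g-space property is used for the subspace [A] and its full subset, whose closure in [A] is
   [A]; countable compactness then makes [A] compact. *)
move=> /(_ A) /(_ setT) h.
have {h} cA : compact A.
  have -> : A = set_val @` [set: A].
    apply/seteqP; split=> [z Az|_ [z _ <-]]; last exact: sub_valP.
    by exists (in_sub Az) => //; rewrite in_subK.
  apply: continuous_compact.
    by apply: continuous_subspaceT; exact: set_val_continuous.
  have <- : closure [set: A] = setT.
    by apply/seteqP; split=> // z _; exact: subset_closure.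
  apply: h.
  move=> B _ iB.
  pose B' := [set x | x <> p /\ exists2 b, B b & set_val b = ev x].
  have iB' : infinite_set B'.
    move=> fB'; apply: iB.
    have : finite_set (set_val @` B).
      apply: sub_finite_set (finite_image ev fB') => _ [b Bb <-].
      by have [x xp e] := sub_valP b; exists x => //; split=> //; exists b.
    move=> fB; apply: (sub_finite_set (@preimage_image _ _ set_val B)).
    by apply: finite_preimage fB => x y _ _; exact: sub_val_inj.
  have [|q qp lq] := cc B' _ iB'; first by case.
  have Aq : A (ev q) by exists q.
  exists (in_sub Aq) => U /sub_nbhs[V]; rewrite in_subK => /ev_cont qV VU.
  have [x [xq [xp [b Bb bx]] Vx]] := lq _ qV.
  exists b; split=> //; last by apply: VU; rewrite bx.
  apply/eqP => e; move/eqP: xq; apply; apply: ev_inj.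
  by rewrite -bx e in_subK.
(* A compact set in a Hausdorff space is closed, but [ev p] is in the closure of [A] and not in
   [A]. *)
have := compact_closed (@Cp_hausdorff _ _) cA; move=> /(_ (ev p))[|x xp /ev_inj e //].
move=> U /ev_cont /lp[x [xp _ Ux]]; exists (ev x); split=> //.
by exists x => //; exact/eqP.
Qed.

(** * Countable tightness and the Lindelof property *)

Lemma nbhs_small_ball (R : realType) (x : R) (V : set R) : nbhs x V ->
  exists k : nat, forall z, (`|z - x| < k.+1%:R^-1)%R -> V z.
Proof.
move=> /nbhs_ballP[e /= e0 eV].
have [k _ /(_ k (leqnn k)) kP] := near_infty_natSinv_lt (PosNum e0).
exists k => z zk; apply: eV; rewrite -ball_normE /= distrC.
exact: lt_trans kP.
Qed.

Lemma nbhs_rat_interval (R : realType) (x : R) (V : set R) : nbhs x V ->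
  exists q r : rat, (ratr q < x < ratr r)%R /\
    forall z, (ratr q < z < ratr r)%R -> V z.
Proof.
move=> /nbhs_ballP[e /= e0 eV].
have [q] := @rat_in_itvoo R (x - e)%R x (ltac:(by rewrite ltrBlDr ltrDl)).
rewrite in_itv /= => /andP[q1 q2].
have [r] := @rat_in_itvoo R x (x + e)%R (ltac:(by rewrite ltrDl)).
rewrite in_itv /= => /andP[r1 r2].
exists q, r; split; first by rewrite q2 r1.
move=> z /andP[qz zr]; apply: eV; rewrite -ball_normE /= ltr_distlC.
by rewrite (lt_trans q1 qz) (lt_trans zr r2).
Qed.

Lemma compact_power (X : topologicalType) n : compact [set: X] -> compact [set: power X n].
Proof.
move=> cX; have := @tychonoff 'I_n (fun=> X) (fun=> setT) (fun=> cX).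
by congr (compact _); apply/seteqP; split.
Qed.

(** By compactness of the power [n] of [X], finitely many members of [A] suffice to approximate [f]
    within 1/(k+1) on every [n]-tuple of points; the union over all [n] and [k] is the countable set
    sought. *)
Lemma Cp_countably_tight (R : realType) (X : topologicalType) :
  compact [set: X] -> countably_tight (Cp R X).
Proof.
move=> cX A f clf.
pose good n k (y : power X n) (g : Cp R X) :=
  forall i, (`|Cp_val g (y i) - Cp_val f (y i)| < k.+1%:R^-1)%R.
have cover n k : exists s : seq (Cp R X), {in s, forall g, A g} /\
    forall y : power X n, exists2 g, g \in s & good n k y g.
  apply: contrapT => nc.
  (* Otherwise the sets of tuples missed by finitely many members of [A] generate a proper filter; a
     function in [A] close to [f] at a cluster point is still close nearby, a contradiction. *)
  pose F : set_system (power X n) := [set N | exists s : seq (Cp R X),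
    {in s, forall g, A g} /\ forall y, {in s, forall g, ~ good n k y g} -> N y].
  have PF : ProperFilter F.
    split.
      move=> [s [sA sN]]; apply: nc; exists s; split=> // y; apply: contrapT => ny.
      by apply: (sN y) => g gs gy; apply: ny; exists g.
    split; first by exists [::].
      move=> N M [s [sA sN]] [t [tA tM]]; exists (s ++ t); split.
        by move=> g; rewrite mem_cat => /orP[/sA|/tA].
      move=> y yst; split; [apply: sN|apply: tM] => g gs;
        by apply: yst; rewrite mem_cat gs ?orbT.
    by move=> N M NM [s [sA sN]]; exists s; split=> // y /sN /NM.
  have [y [_ yF]] := @compact_power X n cX F _ filterT.
  have [|g [Ag /= yg]] := clf [set g | {in enum 'I_n, forall i,
      (`|Cp_val g (y i) - Cp_val f (y i)| < k.+1%:R^-1)%R}].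
    apply: filter_seq => i _.
    apply: (@Cp_eval_continuous R X (y i) f
      [set z | (`|z - Cp_val f (y i)| < k.+1%:R^-1)%R]).
    apply/nbhs_ballP; exists k.+1%:R^-1%R => //= z.
    by rewrite -ball_normE /= distrC.
  have [||y' [ny' gy']] := yF [set y' | ~ good n k y' g] [set y' | good n k y' g].
  - exists [:: g]; split=> [h|y']; first by rewrite inE => /eqP->.
    by move=> /(_ g); apply; rewrite inE.
  - have : nbhs y [set y' : power X n | {in enum 'I_n, forall i,
        (`|Cp_val g (y' i) - Cp_val f (y' i)| < k.+1%:R^-1)%R}].
      apply: filter_seq => i _.
      have evc (h : Cp R X) : (Cp_val h (y' i) @[y' --> y] --> Cp_val h (y i)).
        apply: (@continuous_comp _ _ _ (fun y' : power X n => y' i) (Cp_val h)).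
          exact: ptws_eval_continuous.
        exact: Cp_val_continuous.
      apply: (cvgr_norm_lt _ (cvgB (evc g) (evc f))).
      by apply: yg; rewrite mem_enum.
    by apply: filterS => y' h i; apply: h; rewrite mem_enum.
  - by apply: ny'.
have /choice[s sP] (nk : nat * nat) := cover nk.1 nk.2.
exists (\bigcup_nk [set` s nk]); split.
- by move=> g [nk _ /= gs]; have [+ _] := sP nk; exact.
- apply: bigcup_countable => // nk _.
  exact/finite_set_countable/finite_seq.
move=> U /Cp_nbhs[t [V [tV VU]]].
have [k kV] : exists k : nat, {in t, forall x z,
    (`|z - Cp_val f x| < k.+1%:R^-1)%R -> V x z}.
  elim: t {VU} => [|x t [k kV]]; first by exists 0%N.
  have [l lV] := nbhs_small_ball (tV x).
  have inv a b : (a <= b)%N -> (b.+1%:R^-1 <= a.+1%:R^-1 :> R)%R.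
    by move=> ab; rewrite lef_pV2 ?posrE// ler_nat ltnS.
  exists (maxn k l) => x'; rewrite inE => /orP[/eqP->|x't] z zm.
  - by apply: lV; apply: lt_le_trans zm _; exact/inv/leq_maxr.
  - by apply: kV => //; apply: lt_le_trans zm _; exact/inv/leq_maxl.
have [_ /(_ (fun i => tnth (in_tuple t) i))[g gs gg]] := sP (size t, k).
exists g; split; first by exists (size t, k).
apply: VU => x /(tnthP (in_tuple t))[i ->]; apply: kV; last exact: gg.
exact: mem_tnth.
Qed.

Section Lindelof.
Context (R : realType) (X : topologicalType) (n : nat).

(** The pattern [c] gives, for each point of [y], a component of [G] and the ends of an interval.
    There are countably many patterns, so only [y] ranges over an uncountable set. *)
Definition rational_box m (c : m.-tuple ('I_n * rat * rat)) (y : power X m)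
    (G : power (Cp R X) n) :=
  forall k : 'I_m, (ratr (tnth c k).1.2 <
     Cp_val (G (tnth c k).1.1) (y k) < ratr (tnth c k).2)%R.

Lemma nbhs_rational_box (G : power (Cp R X) n) (U : set (power (Cp R X) n)) :
  nbhs G U -> exists m (c : m.-tuple ('I_n * rat * rat)) (y : power X m),
    rational_box c y G /\ forall G', rational_box c y G' -> U G'.
Proof.
move=> /ptws_nbhs_box[s [N [GN NU]]].
have /choice[t tP] i := Cp_nbhs (GN i).
have /choice[V VP] := tP.
have /choice[qr qrP] (p : 'I_n * X) : exists qr : rat * rat,
    (ratr qr.1 < Cp_val (G p.1) p.2 < ratr qr.2)%R /\
    forall z, (ratr qr.1 < z < ratr qr.2)%R -> V p.1 p.2 z.
  have [/(_ p.2)/nbhs_rat_interval[q [r ?]] _] := VP p.1.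
  by exists (q, r).
pose l := [seq (i, x) | i <- s, x <- t i].
exists (size l), (map_tuple (fun p => (p.1, (qr p).1, (qr p).2)) (in_tuple l)).
exists (fun k => (tnth (in_tuple l) k).2); split.
  by move=> k; rewrite tnth_map /=; have [] := qrP (tnth (in_tuple l) k).
move=> G' G'l; apply: NU => i si; have [_] := VP i; apply => x xt.
have /tnthP[k ek] : (i, x) \in in_tuple l by apply/allpairsPdep; exists i, x.
have [_] := qrP (i, x); apply.
by have := G'l k; rewrite tnth_map /= -ek.
Qed.

Lemma rational_box_open m (c : m.-tuple ('I_n * rat * rat)) (G : power (Cp R X) n) :
  open [set y | rational_box c y G].
Proof.
rewrite openE => y yG; rewrite /interior /=.
have : nbhs y [set y' : power X m | {in enum 'I_m, forall k,
    (ratr (tnth c k).1.2 < Cp_val (G (tnth c k).1.1) (y' k) < ratr (tnth c k).2)%R}].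
  apply: filter_seq => k _.
  pose h (y' : power X m) := Cp_val (G (tnth c k).1.1) (y' k).
  have hc : {for y, continuous h}.
    apply: (@continuous_comp _ _ _ (fun y' : power X m => y' k) (Cp_val (G (tnth c k).1.1))).
      exact: ptws_eval_continuous.
    exact: Cp_val_continuous.
  apply: (hc [set z | (ratr (tnth c k).1.2 < z < ratr (tnth c k).2)%R]).
  rewrite (_ : [set _ | _] = `](ratr (tnth c k).1.2 : R), (ratr (tnth c k).2)[%classic).
    by apply: open_nbhs_nbhs; split; [exact: itv_open|rewrite /= in_itv; exact: yG].
  by apply/seteqP; split=> z; rewrite /= in_itv.
by apply: filterS => y' h k; apply: h; rewrite mem_enum.
Qed.

(** For a fixed pattern, let [A] be the set of tuples whose box lies in a member of the cover. The
    tuples whose box contains a given [G] form an open set, so a countable dense subset of [A] gives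
    boxes covering the same functions. *)
Lemma Cp_power_lindelof :
  (forall m, hereditarily_separable (power X m)) -> lindelof (power (Cp R X) n).
Proof.
move=> hs U Uo Ucov.
have /choice[V VP] (mc : {m & m.-tuple ('I_n * rat * rat)}) :
    exists V : set (set (power (Cp R X) n)), [/\ V `<=` U, countable V &
      forall y u, U u -> rational_box (projT2 mc) y `<=` u ->
        rational_box (projT2 mc) y `<=` \bigcup_(v in V) v].
  case: mc => m c /=.
  pose A := [set y : power X m | exists2 u, U u & rational_box c y `<=` u].
  have /separable_sub[D [DA cD dD]] := hs m A.
  have /choice[u uP] (y : power X m) : exists u, A y -> U u /\ rational_box c y `<=` u.
    case: (pselect (A y)) => [[u ? ?]|?]; last by exists set0.
    by exists u.
  exists (u @` D); split.
  - by move=> _ [y Dy <-]; have [] := uP y (DA y Dy).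
  - by apply: sub_countable cD; exact: card_image_le.
  move=> y u0 Uu0 yu0 G yG.
  have [|y' [y'G Dy']] := dD _ (rational_box_open c G).
    by exists y; split=> //; exists u0.
  exists (u y'); first by exists y'.
  by have [_] := uP y' (DA y' Dy'); exact.
exists (\bigcup_mc V mc); split.
- by move=> v [mc _ Vv]; have [+ _ _] := VP mc; exact.
- apply: bigcup_countable => [|mc _]; first exact: countableP.
  by have [] := VP mc.
apply/seteqP; split=> // G _.
have [u Uu uG] : (\bigcup_(u in U) u) G by rewrite Ucov.
have [m [c [y [yG yu]]]] := nbhs_rational_box (open_nbhs_nbhs (conj (Uo u Uu) uG)).
have [_ _ /(_ y u Uu yu G yG)[v Vv vG]] := VP (existT _ m c).
by exists v => //; exists (existT _ m c).
Qed.

End Lindelof.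

(** * The space of threads *)

Lemma nbhs_bool (b : bool) (U : set bool) : nbhs b U <-> U b.
Proof.
split; first exact: nbhs_singleton.
by move=> Ub; rewrite nbhs_principalE; apply/principal_filterP.
Qed.

Lemma nbhs_agree_on d (W : orderType d) (y : {ptws W -> bool}) (E : seq W) :
  nbhs y [set z | agree_on E z y].
Proof.
apply: filter_seq => a _.
apply: (@ptws_eval_continuous W bool a y [set b | b = y a]).
exact/nbhs_bool.
Qed.

Lemma inj_card_leT (T U : Type) (h : T -> U) : injective h -> [set: T] #<= [set: U].
Proof.
move=> hi; apply: card_le_trans (card_leT (range h)).
have /card_eqPle[] : h @` [set: T] #= [set: T] by apply: inj_card_eq => x y _ _ /hi.
by [].
Qed.

Lemma uncountable_powerset : ~ countable [set: set nat].
Proof.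
move=> /countable_injP[h hi].
pose N := [set n | exists A, h A = n /\ ~ A n].
have NP : N (h N) <-> ~ N (h N).
  split=> [[A [e nA]]|nN]; last by exists N.
  have eA : A = N by apply: hi e; rewrite inE.
  by rewrite eA in nA.
have nN : ~ N (h N) by move=> /[dup] /NP.
exact/nN/NP.
Qed.

Section ThreadSpace.
Context d (W : orderType d) (hW : is_omega1 W).
Context (c : W -> nat -> W -> W).
Hypothesis cI : forall a i b a' i' b',
  c a i b = c a' i' b' -> [/\ a = a', i = i' & b = b'].
Context (S : W -> set W) (hS : diamond_sequence S).
Let D b : W -> bool := fun x => x \in S b.
Context (f : W -> (W -> bool) -> bool).
Hypothesis fS : forall a, splits c D f a (f a).

Let Y0 : set {ptws W -> bool} := [set y | full_thread S f y].
Let Y : topologicalType := Y0.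

Lemma thread_nbhs (y : Y) (U : set Y) : nbhs y U ->
  exists E : seq W, forall z : Y, agree_on E (set_val z) (set_val y) -> U z.
Proof.
move=> /sub_nbhs[V /ptws_nbhs_box[E [N [yN NV]]] VU].
exists E => z zy; apply/VU/NV => a aE.
by rewrite zy//; have /nbhs_bool := yN a.
Qed.

Lemma nbhs_thread (y : Y) (E : seq W) :
  nbhs y [set z : Y | agree_on E (set_val z) (set_val y)].
Proof. exact: (set_val_continuous (nbhs_agree_on (set_val y : {ptws W -> bool}) E)). Qed.

Lemma thread_coordinate_continuous (a : W) :
  continuous (fun y : Y => (set_val y : W -> bool) a).
Proof.
move=> y U /nbhs_bool Uy; apply: filterS (nbhs_thread y [:: a]) => z zy /=.
by rewrite zy ?mem_head.
Qed.

Lemma thread_neq (y z : Y) : y <> z -> exists a : W,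
  (set_val y : W -> bool) a <> (set_val z : W -> bool) a.
Proof.
move=> yz; apply: contrapT => n; apply/yz/sub_val_inj/funext => a.
by apply: contrapT => ne; apply: n; exists a.
Qed.

Lemma thread_hausdorff : hausdorff_space Y.
Proof.
apply: separated_hausdorff => y z /thread_neq[a ne].
exists bool, (fun y : Y => (set_val y : W -> bool) a); split=> //.
  exact: discrete_hausdorff.
exact: thread_coordinate_continuous.
Qed.

Lemma thread_compact : compact [set: Y].
Proof.
apply: compact_sub; apply: (@subclosed_compact _ Y0 [set: {ptws W -> bool}]) => //.
  move=> y ycl; apply/(full_threadP hW) => a na; apply: contrapT => ne.
  (* As [f a] is continuous off [D a], a violation at [a] is visible on finitely many coordinates,
     so the threads form a closed set. *)
  have [f1 _ _] := fS a; have [E [Ea EP]] := f1 y na.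
  have [z [zY zy]] := ycl _ (nbhs_agree_on y (a :: E)).
  have [|nz fz] := EP z.
    by apply: agree_onC; apply: agree_on_sub zy => e eE; rewrite inE eE orbT.
  apply: ne; rewrite -fz -(zy a) ?mem_head//.
  by move/(full_threadP hW): zY; exact.
have := @tychonoff W (fun=> bool) (fun=> setT) (fun=> bool_compact).
by congr (compact _); apply/seteqP; split.
Qed.

(** A nonseparable subspace would contain a sequence of length omega_1 with each term outside the
    closure of the earlier ones, against [no_left_separated]. *)
Lemma thread_hereditarily_separable n : hereditarily_separable (power Y n).
Proof.
move=> A; apply/separable_sub; apply: contrapT => ns.
have bad (B : set (power Y n)) : B `<=` A -> countable B ->
    exists2 y, A y & ~ closure B y.
  move=> BA cB; apply: contrapT => nb; apply: ns; exists B; split=> // U oU [y [Uy Ay]].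
  have : closure B y by apply: contrapT => ny; apply: nb; exists y.
  by move=> /(_ U (open_nbhs_nbhs (conj oU Uy))); rewrite setIC.
have [y0 _ _] := bad set0 (fun _ => False_ind _) (@countable0 _).
(* Intersecting with [A] makes the choice possible for an arbitrary history [h], even one that
   leaves [A]. *)
have [||h hP] := transfinite_choice hW y0 (P := fun a h v => A v /\
    ~ closure (h @` [set b | b < a] `&` A) v).
- move=> a h h' v hh [Av nv]; split=> //; apply: contra_not nv.
  apply: closure_subset => _ [[b ba <-] Ab]; split; last by [].
  by exists b => //; rewrite hh.
- move=> a h; have [||y Ay ny] := bad (h @` [set b | b < a] `&` A).
  + by move=> ? [].
  + apply: (sub_countable (B := h @` [set b | b < a])).
      by apply: subset_card_le => ? [].
    by apply: sub_countable (countable_lt hW a); exact: card_image_le.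
  + by exists y.
pose a (xi : W) (i : nat) : W -> bool :=
  if insub i is Some k then set_val (h xi k) else fun=> false.
have aE xi (k : 'I_n) : a xi k = set_val (h xi k) by rewrite /a valK.
have [|xi xiP] := @no_left_separated _ W hW c cI S hS f fS [seq val k | k <- enum 'I_n] a.
  by move=> xi i /mapP[k _ ->]; rewrite aE; exact: (sub_valP (h xi k)).
have [_] := hP xi; apply=> U /ptws_nbhs_box[s [N [hN NU]]].
have /choice[E EP] k := thread_nbhs (hN k).
have [eta lt etaP] := xiP (flatten [seq E k | k <- enum 'I_n]).
exists (h eta); split.
  by split; [exists eta|have [] := hP eta].
apply: NU => k _; apply: EP => x xE; have := etaP k.
rewrite !aE; apply; first by rewrite map_f// mem_enum.
by apply/flatten_mapP; exists k; rewrite ?mem_enum.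
Qed.

Lemma thread_limit_point (p : Y) : limit_point [set: Y] p.
Proof.
move=> U /thread_nbhs[E EP].
have [a0 _] := omega1_inhabited hW.
have [b _ bE] := exists_above hW a0 E.
have [q [qf qp qnp]] := full_thread_split hW hS fS b (sub_valP p).
exists (@in_sub _ Y0 q qf); split=> //.
  by apply/eqP => e; apply: qnp; rewrite -e in_subK.
by apply: EP; rewrite in_subK; exact: agree_below qp.
Qed.

(** Compactness gives a limit point of a sequence in [B]; if it is [p], [no_unique_limit] supplies
    another. *)
Lemma thread_other_limit_point (p : Y) (B : set Y) : ~ B p -> infinite_set B ->
  exists2 q, q <> p & limit_point B q.
Proof.
move=> Bp /infiniteP/card_le_setT_inj[t ti tB].
have [|x lx] := @infinite_limit_point Y (range t) thread_compact.
  by apply/infiniteP; have /card_eqPle[] : range t #= [set: nat]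
    by apply: inj_card_eq => i j _ _ /ti.
have [xp|xp] := pselect (x = p); last first.
  exists x => // U /lx[y [yx [k _ tky] Uy]].
  by exists y; split=> //; rewrite -tky; exact: tB.
have [||k||q [qf qp qlim]] := @no_unique_limit _ W hW c cI S hS f fS
    (set_val p) (fun k => set_val (t k)).
- exact: (sub_valP p).
- by move=> k; exact: (sub_valP (t k)).
- by move=> /(@sub_val_inj _ Y0) e; apply: Bp; rewrite -e; exact: tB.
- move=> E; have [y [_ [k _ <-] yE]] := lx _ (nbhs_thread x E).
  by exists k; rewrite -xp.
exists (@in_sub _ Y0 q qf).
  by move=> e; apply: qp; rewrite -e in_subK.
move=> U /thread_nbhs[E EP]; have [k [tq tE]] := qlim E.
exists (t k); split; [|exact: tB|by apply: EP; rewrite in_subK].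
by apply/eqP => e; apply: tq; rewrite e in_subK.
Qed.

(** The diamond sequence guesses every subset of a countable set of ordinals, so the continuum
    injects into [W]. The image is uncountable and thus contains an increasing omega_1-sequence,
    which gives the converse injection. *)
Lemma omega1_card : exists (phi : set nat -> W) (psi : W -> set nat),
  injective phi /\ injective psi.
Proof.
have /infiniteP/card_le_setT_inj[j ji _] : infinite_set [set: W].
  by move=> /finite_set_countable; exact: uncountable_omega1.
have /choice[phi phiP] (A : set nat) : exists a, forall n, A n <-> S a (j n).
  have [a [aS aj]] := @diamond_reflection _ W hW S (fun=> range j) (j @` A) hS
    (fun=> sub_countable (card_image_le _ _) (countableP _)).
  exists a => n; rewrite -aS; split=> [An|[[m Am /ji <-]]//].
  by split; [exists n|apply: (aj [::]) => //; exists n].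
have phi_inj : injective phi.
  by move=> A B e; apply/seteqP; split=> n /phiP ?; apply/phiP; congruence.
have [||g [gU glt]] := @thinning _ W hW (range phi) (fun=> set0).
- move=> /countable_injP[h hi]; apply: uncountable_powerset.
  apply/countable_injP; exists (h \o phi) => A B _ _ /hi.
  by rewrite !inE => /(_ (ex_intro2 _ _ A I erefl) (ex_intro2 _ _ B I erefl))/phi_inj.
- by move=> _; exact: countable0.
have /choice[psi psiP] a : exists A, phi A = g a.
  by have [A _ <-] := gU a; exists A.
exists phi, psi; split=> // a b e.
have ge : g a = g b by rewrite -!psiP e.
by case: (ltgtP a b) => // /glt[]; rewrite ge ltxx.
Qed.

Lemma thread_card : [set: Y] #= [set: set (set nat)].
Proof.
have [phi [psi [phi_inj psi_inj]]] := omega1_card.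
apply/card_eqPle; split.
- apply: (@inj_card_leT _ _ (fun y : Y => psi @` [set a | (set_val y : W -> bool) a])).
  move=> y z e; apply/sub_val_inj/funext => a.
  have iff (u v : Y) : [set psi x | x in [set a | (set_val u : W -> bool) a]] =
      [set psi x | x in [set a | (set_val v : W -> bool) a]] ->
      (set_val u : W -> bool) a -> (set_val v : W -> bool) a.
    move=> uv ua; have : ([set psi x | x in [set a | (set_val u : W -> bool) a]]) (psi a).
      by exists a.
    by rewrite uv => -[b vb /psi_inj <-].
  by apply/idP/idP; exact: iff.
- have [F [Finj Ff]] := full_thread_embedding hW hS fS.
  pose G (B : set (set nat)) : W -> bool := fun a => `[< exists A, B A /\ phi A = a >].
  apply: (@inj_card_leT _ _ (fun B => @in_sub _ Y0 (F (G B)) (Ff (G B)) : Y)).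
  move=> B C /(congr1 set_val); rewrite !in_subK => /Finj e.
  have sub B' C' : G B' = G C' -> B' `<=` C'.
    move=> e' A B'A; have : G B' (phi A) by apply/asboolP; exists A.
    by rewrite e' => /asboolP[A' [C'A' /phi_inj <-]].
  by apply/seteqP; split; exact: sub.
Qed.

Lemma thread_inhabited : exists p : Y, True.
Proof.
have [F [_ Ff]] := full_thread_embedding hW hS fS.
by exists (@in_sub _ Y0 _ (Ff (fun=> false))).
Qed.

Lemma thread_Cp_separates (R : realType) (x y : Y) : x <> y ->
  exists2 h : Y -> R, continuous h & h x <> h y.
Proof.
move=> /thread_neq[a ne].
exists (fun z => if (set_val z : W -> bool) a then 1%R else 0%R : R).
  move=> z U Uz; apply: filterS (nbhs_thread z [:: a]) => t tz /=.
  by rewrite tz ?mem_head//; exact: nbhs_singleton.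
move: ne; case: (_ a); case: (_ a) => // _ /eqP; first by rewrite oner_eq0.
by rewrite eq_sym oner_eq0.
Qed.

Lemma thread_space (R : realType) : exists Y : topologicalType,
  (hausdorff_space Y /\ completely_regular_space Y) /\
  compact [set: Y] /\
  [set: Y] #= [set: set (set nat)] /\
  (forall n : nat, hereditarily_separable (power Y n)) /\
  countably_tight (Cp R Y) /\
  (forall n : nat, lindelof (power (Cp R Y) n)) /\
  ~ Grothendieck_space R (Cp R Y).
Proof.
exists Y; split.
  split; first exact: thread_hausdorff.
  apply: (@normal_completely_regular R).
    by apply: compact_normal; [exact: thread_hausdorff|exact: thread_compact].
  by apply: hausdorff_accessible; exact: thread_hausdorff.
split; first exact: thread_compact.
split; first exact: thread_card.
split; first exact: thread_hereditarily_separable.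
split; first by apply: Cp_countably_tight; exact: thread_compact.
split; first by move=> n; apply: Cp_power_lindelof; exact: thread_hereditarily_separable.
have [p _] := thread_inhabited.
apply: (@not_Grothendieck_Cp R Y p).
- exact: thread_Cp_separates.
- exact: thread_limit_point.
- exact: thread_other_limit_point.
Qed.

End ThreadSpace.

Theorem mainTheorem2 (R : realType) (hdiamond : diamond)
    (hKurepa : Kurepa_hypothesis) :
  exists Y : topologicalType,
    (hausdorff_space Y /\ completely_regular_space Y) /\
    compact [set: Y] /\
    [set: Y] #= [set: set (set nat)] /\
    (forall n : nat, hereditarily_separable (power Y n)) /\
    countably_tight (Cp R Y) /\
    (forall n : nat, lindelof (power (Cp R Y) n)) /\
    ~ Grothendieck_space R (Cp R Y).
Proof.
have [d [W [hW [S hS]]]] := hdiamond.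
have [c cI] := omega1_coding hW.
have [f fS] := splitting_family hW c (fun b x => x \in S b).
exact: (thread_space hW cI hS fS R).
Qed.
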